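(* Let $\rho>0$, $m\in(-\sqrt\rho,\sqrt\rho)$, $\mu=-\frac m{\rho-m^2}$ and $\eta=\frac1{2(\rho-m^2)}$. Let $I\subset\Lambda$ be an index set of fixed size, and let $f:\mathbb{R}^{|I|}\to\mathbb{R}$ be either a bounded $1$-Lipschitz function with respect to $\|\cdot\|_2$, or a finite product of coordinates of finite order (a monomial $\prod_{\ell=1}^{k}y_{j_\ell}$ with $k$ fixed). Then \[ \langle f\circ P_I\rangle_{\mathrm{MC}}^{m,\rho;N}=\langle f\circ P_I\rangle_{\mathrm{GC}}^{\mu,\eta;N}+O(N^{-1/2}). \]
   Context: $\Lambda$ finite lattice, $N=|\Lambda|$, $\phi\in\mathbb{R}^\Lambda$, $M[\phi]=\sum_x\phi_x$, $N[\phi]=\sum_x\phi_x^2$; $P_I$ restricts to sites in $I$. $\mu_{\mathrm{MC}}^{m,\rho;N}$ is the normalized uniform surface measure on $\{M[\phi]=mN,\ N[\phi]=\rho N\}$. The auxiliary grand canonical ensemble $\mu_{\mathrm{GC}}^{\mu,\eta;N}$ ($\mu\in\mathbb{R}$, $\eta>0$) has density on $\mathbb{R}^N$ proportional to $e^{-\mu M[\phi]-\eta N[\phi]}$. *)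

(* Defs.v *)
From HB Require Import structures.
From mathcomp Require Import all_boot all_order all_algebra.
From mathcomp Require Import all_classical all_reals all_analysis.
Set Implicit Arguments. Unset Strict Implicit. Unset Printing Implicit Defensive.
Import Order.TTheory GRing.Theory Num.Theory.
Local Open Scope ring_scope.

Section Defs.
Variable R : realType.

(* M[phi] = sum_x phi_x  and  N[phi] = sum_x phi_x^2 ; a configuration
   phi in R^Lambda is a list of length N = |Lambda|. *)
Definition sumM (s : seq R) : R := \sum_(x <- s) x.
Definition sumN (s : seq R) : R := \sum_(x <- s) x ^+ 2.

(* Iterated Lebesgue integral over R^n of a function of the coordinate
   list (s has length n); for nonnegative measurable functions this is the
   integral w.r.t. n-dimensional Lebesgue measure (Tonelli). *)
Fixpoint iint (n : nat) (g : seq R -> \bar R) : \bar R :=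
  match n with
  | 0 => g [::]
  | n'.+1 => (\int[@lebesgue_measure R]_x iint n' (fun s => g (x :: s)))%E
  end.

Definition lint (n : nat) (g : seq R -> \bar R) : \bar R :=
  (iint n (fun s => maxe (g s) 0%E) - iint n (fun s => maxe (- g s) 0%E))%E.

Definition gc_weight (mu eta : R) (phi : seq R) : R :=
  expR (- mu * sumM phi - eta * sumN phi).

Definition gc_expect (mu eta : R) (N : nat) (g : seq R -> R) : \bar R :=
  (lint N (fun phi => (g phi * gc_weight mu eta phi)%:E) *
   ((fine (iint N (fun phi => (gc_weight mu eta phi)%:E)))^-1)%:E)%E.

(* Microcanonical ensemble: normalized uniform surface measure on the
   (N-2)-sphere S = {M[phi] = mN, N[phi] = rho N}, i.e. the sphere of
   centre m*1 and radius r = sqrt(N(rho - m^2)) inside the affine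
   hyperplane H = {M[phi] = mN}.  Following the polar-coordinate
   definition of surface measure, sigma(A) = vol_H(cone(A)) / vol_H(B),
   where B is the ball of H bounded by S and cone(A) is the set of points
   of B (other than the centre) whose radial projection onto S lies in A.
   H is parametrized by its first N-1 coordinates (an affine bijection
   R^{N-1} -> H, which scales (N-1)-volume by a constant factor that
   cancels in the normalization). *)
Definition hyp_emb (m : R) (N : nat) (psi : seq R) : seq R :=
  rcons psi (m * N%:R - sumM psi).

Definition radial_proj (m r : R) (phi : seq R) : seq R :=
  let d := [seq x - m | x <- phi] in
  let nd := Num.sqrt (sumN d) in
  [seq m + r * (y / nd) | y <- d].

Definition in_ball (m rho : R) (N : nat) (psi : seq R) : bool :=
  sumN (hyp_emb m N psi) < rho * N%:R.

Definition mc_expect (m rho : R) (N : nat) (g : seq R -> R) : \bar R :=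
  let r := Num.sqrt (N%:R * (rho - m ^+ 2)) in
  (lint N.-1 (fun psi => if in_ball m rho N psi
                         then (g (radial_proj m r (hyp_emb m N psi)))%:E
                         else 0%E) *
   ((fine (iint N.-1 (fun psi => if in_ball m rho N psi then 1%E else 0%E)))^-1)%:E)%E.

Definition proj_I (n : nat) (I : 'I_n -> nat) (phi : seq R) : 'I_n -> R :=
  fun i => nth 0 phi (I i).

Definition bounded_1lipschitz (n : nat) (f : ('I_n -> R) -> R) : Prop :=
  (exists B : R, forall y, `|f y| <= B) /\
  (forall y z, `|f y - f z| <= Num.sqrt (\sum_(i < n) (y i - z i) ^+ 2)).

Definition coord_monomial (n : nat) (f : ('I_n -> R) -> R) : Prop :=
  exists (k : nat) (j : 'I_k -> 'I_n), forall y, f y = \prod_(l < k) y (j l).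

End Defs.

(* Main.v *)
(** Let X be a standard Gaussian vector of R^N, X' = X - mean X and
  T = sqrt N X' / |X'|. On the hyperplane of vectors with zero sum, a function
  homogeneous of degree 0 has the same average over the unit ball and for the
  Gaussian weight (layer cake and scaling), so with s = sqrt (rho - m^2) the
  microcanonical ensemble is the law of m + s T, while the grand canonical one is
  the law of m + s X. In this coupling
    sqrt N (T_i - X_i) = T_i sqrt N (1 - |X'| / sqrt N) - sqrt N mean X,
  and all moments of the three random variables T_i, sqrt N (1 - |X'|^2 / N) and
  sqrt N mean X are bounded uniformly in N. *)
Require Import Defs.
From HB Require Import structures.
From mathcomp Require Import all_boot all_order all_algebra.
From mathcomp Require Import all_classical all_reals all_analysis.
From mathcomp Require Import measurable_realfun ring lra.
Import Order.TTheory GRing.Theory Num.Theory.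
Local Open Scope ring_scope.

(** * Iterated Lebesgue integrals *)

(** The constants linking surface measure, ball and Gaussian weight are never computed: each is one
    factor common to all degree-0 homogeneous functions, the constant function 1 shows the resulting
    ratio positive and finite, and it cancels in the normalization. Integrals are taken of
    nonnegative functions, so that Tonelli suffices; signs enter at the end, through positive and
    negative parts. The delicate point is the moments of T_i, which contain a negative power of
    |X'|. Inverse moments of |X'| are avoided: rescaling the Gaussian weight compares the moment
    with itself, and the contribution of small |X'| is absorbed as a fraction of the whole, which is
    finite because |T_i| <= sqrt N. Monomials multiply such variables, so moments of all orders are
    carried along. Bounds must be uniform in N and in I, hence random variables come in families
    indexed by pairs (N, I). The threshold N >= 16 serves two explicit estimates: the exponential
    moments of |X|^2, where 1 / sqrt N <= 1/4 is used, and the size 2/3 of the absorbed fraction. *)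

Section iterated_integral.
Context {R : realType}.
Local Notation mu := (@lebesgue_measure R).
Local Open Scope ereal_scope.

(** The image of Lebesgue measure under x |-> a x + b, scaled by a, gives every half-open interval
    its length, and this characterizes Lebesgue measure. *)
Lemma ge0_integral_affine (a b : R) (f : R -> \bar R) :
  (0 < a)%R -> measurable_fun setT f -> (forall x, 0 <= f x) ->
  \int[mu]_x f x = a%:E * \int[mu]_x f (a * x + b)%R.
Proof.
move=> a0 mf f0.
pose phi : measurableTypeR R -> measurableTypeR R := fun x : R => (a * x + b)%R.
have mphi : measurable_fun setT phi.
  by apply: measurable_funD => //; exact: mulrl_measurable.
pose nu : measure _ R := pushforward mu phi.
pose k : {nonneg R} := NngNum (ltW a0).
rewrite (eq_measure_integral (mscale k (nu mphi))); last first.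
  move=> A mA _; apply: lebesgue_measure_unique => // X [[c d] _ <-] /=.
  rewrite /mscale /nu /pushforward/=.
  rewrite [X in _ = _ * mu X](_ : _ = `]((c - b) / a)%R, ((d - b) / a)%R]%classic);
    last first.
    apply/seteqP; split => x; rewrite /phi/= !in_itv/= ltr_pdivrMr// ler_pdivlMr//;
      rewrite ltrBlDr lerBrDr [(x * a)%R]mulrC //.
  rewrite !lebesgue_measure_itv/= !lte_fin ltr_pM2r ?invr_gt0// ltrD2r.
  case: ifPn => _; last by rewrite mule0.
  by rewrite -!EFinB -EFinM; congr EFin; field; rewrite gt_eqF.
rewrite ge0_integral_mscale//; congr (_ * _).
by rewrite ge0_integral_pushforward// => x _.
Qed.

(* [seq R] carries no sigma-algebra: a function of lists of length [n] is called
   measurable when substituting measurable functions for the coordinates (and for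
   the parameter) always gives a measurable function. *)
Definition pmeas {d} {T : measurableType d} (n : nat)
    (G : T -> seq R -> \bar R) : Prop :=
  forall d' (T' : measurableType d') (p : T' -> T) (h : nat -> T' -> R),
    measurable_fun setT p -> (forall i, measurable_fun setT (h i)) ->
    measurable_fun setT (fun t => G (p t) (mkseq (h ^~ t) n)).

Definition emeas (n : nat) (g : seq R -> \bar R) : Prop :=
  forall d' (T' : measurableType d') (h : nat -> T' -> R),
    (forall i, measurable_fun setT (h i)) ->
    measurable_fun setT (fun t => g (mkseq (h ^~ t) n)).

Lemma mkseq_cons (T : Type) (f : nat -> T) n :
  mkseq f n.+1 = f 0%N :: mkseq (fun i => f i.+1) n.
Proof. by rewrite /mkseq /= (iotaDl 1) -map_comp. Qed.

Lemma map_mkseq (T U : Type) (k : T -> U) (f : nat -> T) n :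
  [seq k x | x <- mkseq f n] = mkseq (fun i => k (f i)) n.
Proof. by rewrite /mkseq -map_comp. Qed.

Lemma pmeas_emeas {d} {T : measurableType d} n (G : T -> seq R -> \bar R) t :
  pmeas n G -> emeas n (G t).
Proof. by move=> mG d' T' h mh; apply: (mG _ _ (fun=> t)). Qed.

Lemma pmeas_cons {d} {T : measurableType d} n (G : T -> seq R -> \bar R) :
  pmeas n.+1 G -> pmeas n (fun (z : T * R) s => G z.1 (z.2 :: s)).
Proof.
move=> mG d' T' p h mp mh.
have := mG _ _ (fst \o p)
  (fun i => if i is j.+1 then h j else (snd \o p : T' -> R)).
under eq_fun do rewrite mkseq_cons.
apply; first exact: measurableT_comp.
by case=> [|i]//; exact: measurableT_comp.
Qed.

Lemma pmeas_cons_emeas n g : emeas n.+1 g -> pmeas n (fun x s => g (x :: s)).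
Proof.
move=> mg d' T' p h mp mh.
have := mg _ _ (fun i => if i is j.+1 then h j else (p : T' -> R)).
under eq_fun do rewrite mkseq_cons.
by apply; case.
Qed.

Lemma emeas_cons n g x : emeas n.+1 g -> emeas n (fun s => g (x :: s)).
Proof. by move=> /pmeas_cons_emeas /pmeas_emeas. Qed.

Lemma iint_ge0 n (g : seq R -> \bar R) : (forall s, 0 <= g s) -> 0 <= iint n g.
Proof.
elim: n g => [|n ih] g g0 //=.
by apply: integral_ge0 => x _; exact: ih.
Qed.

Lemma eq_iint n (g1 g2 : seq R -> \bar R) :
  (forall s, size s = n -> g1 s = g2 s) -> iint n g1 = iint n g2.
Proof.
elim: n g1 g2 => [|n ih] g1 g2 e /=; first exact: e.
by apply: eq_integral => x _; apply: ih => s ss; apply: e; rewrite /= ss.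
Qed.

Lemma measurable_iint {d} {T : measurableType d} n (G : T -> seq R -> \bar R) :
  (forall t s, 0 <= G t s) -> pmeas n G ->
  measurable_fun setT (fun t => iint n (G t)).
Proof.
elim: n d T G => [|n ih] d T G G0 mG /=.
  by apply: (mG _ _ id (fun=> cst 0%R)).
apply: (@measurable_fun_fubini_tonelli_F _ _ _ _ _ mu
  (fun z : T * R => iint n (fun s => G z.1 (z.2 :: s)))).
- exact: (ih _ _ (fun (z : T * R) s => G z.1 (z.2 :: s)) _ (pmeas_cons _ _ mG)).
- by move=> z; exact: iint_ge0.
Qed.

Lemma measurable_iint_cons n g :
  (forall s, 0 <= g s) -> emeas n.+1 g ->
  measurable_fun setT (fun x : R => iint n (fun s => g (x :: s))).
Proof.
move=> g0 mg.
exact: (measurable_iint _ (fun x s => g (x :: s)) _ (pmeas_cons_emeas _ _ mg)).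
Qed.

(** One exchange with the outermost coordinate by Tonelli on R x R; the induction treats the
    remaining coordinates with that one frozen. *)
Lemma iint_tonelli n (G : R -> seq R -> \bar R) :
  (forall t s, 0 <= G t s) -> pmeas n G ->
  \int[mu]_x iint n (G x) = iint n (fun s => \int[mu]_x G x s).
Proof.
elim: n G => [|n ih] G G0 mG //=.
etransitivity; first apply: (@fubini_tonelli _ _ _ _ _ mu mu
    (fun z : R * R => iint n (fun s => G z.1 (z.2 :: s)))); last first.
- apply: eq_integral => y _ /=; apply: (ih (fun x s => G x (y :: s))) => //.
  move=> d' T' p h mp mh.
  apply: (pmeas_cons _ _ mG _ _ (fun t => (p t, y))) => //.
  exact: measurable_fun_pair.
- by move=> z; exact: iint_ge0.
- exact: (measurable_iint _ (fun (z : R * R) s => G z.1 (z.2 :: s))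
    _ (pmeas_cons _ _ mG)).
Qed.

Lemma pmeas_integral n (G : R -> seq R -> \bar R) :
  (forall t s, 0 <= G t s) -> pmeas n G -> emeas n (fun s => \int[mu]_x G x s).
Proof.
move=> G0 mG d' T' h mh.
apply: (@measurable_fun_fubini_tonelli_F _ _ _ _ _ mu
  (fun z : T' * R => G z.2 (mkseq (h ^~ z.1) n))) => //.
apply: (mG _ _ snd (fun i z => h i z.1)) => // i.
exact: (measurableT_comp (mh i)).
Qed.

Lemma le_iint n (g1 g2 : seq R -> \bar R) :
  (forall s, 0 <= g1 s) -> emeas n g1 -> emeas n g2 ->
  (forall s, 0 <= g2 s) -> (forall s, size s = n -> g1 s <= g2 s) ->
  iint n g1 <= iint n g2.
Proof.
elim: n g1 g2 => [|n ih] g1 g2 g10 m1 m2 g20 h /=; first exact: h.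
apply: ge0_le_integral => //.
- by move=> x _; exact: iint_ge0.
- exact: measurable_iint_cons.
- exact: measurable_iint_cons.
- move=> x _; apply: ih => //; [exact: emeas_cons|exact: emeas_cons|].
  by move=> s ss; apply: h; rewrite /= ss.
Qed.

Lemma iintD n (g1 g2 : seq R -> \bar R) :
  (forall s, 0 <= g1 s) -> (forall s, 0 <= g2 s) -> emeas n g1 -> emeas n g2 ->
  iint n (fun s => g1 s + g2 s) = iint n g1 + iint n g2.
Proof.
elim: n g1 g2 => [|n ih] g1 g2 g10 g20 m1 m2 //=.
rewrite -ge0_integralD//.
- by apply: eq_integral => x _; apply: ih => //; exact: emeas_cons.
- by move=> x _; exact: iint_ge0.
- exact: measurable_iint_cons.
- by move=> x _; exact: iint_ge0.
- exact: measurable_iint_cons.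
Qed.

Lemma iintZl n (k : \bar R) (g : seq R -> \bar R) :
  0 <= k -> (forall s, 0 <= g s) -> emeas n g ->
  iint n (fun s => k * g s) = k * iint n g.
Proof.
move=> k0; elim: n g => [|n ih] g g0 mg //=.
rewrite -ge0_integralZl//.
- by apply: eq_integral => x _; apply: ih => //; exact: emeas_cons.
- exact: measurable_iint_cons.
- by move=> x _; exact: iint_ge0.
Qed.

Lemma iint_affine n (a b : R) (g : seq R -> \bar R) : (0 < a)%R ->
  (forall s, 0 <= g s) -> emeas n g ->
  iint n g = (a ^+ n)%:E * iint n (fun s => g [seq (a * x + b)%R | x <- s]).
Proof.
move=> a0; elim: n g => [|n ih] g g0 mg /=; first by rewrite mul1e.
rewrite (ge0_integral_affine a b)//; last 2 first.
- exact: measurable_iint_cons.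
- by move=> x; exact: iint_ge0.
rewrite exprS EFinM -muleA; congr (_ * _).
rewrite -ge0_integralZl//; last 3 first.
- have mF : emeas n.+1 (fun s => g [seq (a * x + b)%R | x <- s]).
    move=> d' T' h mh.
    under eq_fun do rewrite map_mkseq.
    apply: (mg _ _ (fun i t => (a * h i t + b)%R)) => i.
    by apply: measurable_funD => //; exact: measurable_funM.
  exact: (measurable_iint_cons _ _ _ mF).
- by move=> x _; exact: iint_ge0.
- by rewrite lee_fin exprn_ge0// ltW.
by apply: eq_integral => x _; rewrite ih//; exact: emeas_cons.
Qed.

(** The outermost integral runs over the first entry, whereas the chart of the hyperplane solves for
    the last one; this form isolates it. *)
Lemma iint_rcons n (g : seq R -> \bar R) :
  iint n.+1 g = iint n (fun s => \int[mu]_x g (rcons s x)).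
Proof.
elim: n g => [|n ih] g //.
by apply: eq_integral => x _; exact: (ih (fun s => g (x :: s))).
Qed.

End iterated_integral.

(** * Measurability of real functions of lists of fixed length *)

Section measurability.
Context {R : realType}.

Definition rmeas (n : nat) (F : seq R -> R) : Prop :=
  forall d' (T' : measurableType d') (h : nat -> T' -> R),
    (forall i, measurable_fun setT (h i)) ->
    measurable_fun setT (fun t => F (mkseq (h ^~ t) n)).

Lemma rmeas_emeas n F : rmeas n F -> emeas n (fun s => (F s)%:E).
Proof. by move=> mF d' T' h mh; apply/measurable_EFinP; exact: mF. Qed.

Lemma emeas_comp d (T : measurableType d) k g (L : T -> seq R) :
  emeas k g -> (forall t, size (L t) = k) ->
  (forall i, measurable_fun setT (fun t => nth 0 (L t) i)) ->
  measurable_fun setT (fun t => g (L t)).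
Proof.
move=> mg sL mL.
rewrite (_ : (fun t => _) = fun t => g (mkseq (nth 0 (L t)) k)).
  exact: (mg _ _ (fun i t => nth 0 (L t) i)).
by apply/funext => t; rewrite -(sL t) mkseq_nth.
Qed.

Lemma rmeas_comp d (T : measurableType d) k F (L : T -> seq R) :
  rmeas k F -> (forall t, size (L t) = k) ->
  (forall i, measurable_fun setT (fun t => nth 0 (L t) i)) ->
  measurable_fun setT (fun t => F (L t)).
Proof.
by move=> /rmeas_emeas mF sL mL; apply/measurable_EFinP; exact: emeas_comp mF sL mL.
Qed.

Lemma rmeas_cst n (c : R) : rmeas n (fun=> c).
Proof. by move=> d' T' h mh; exact: measurable_cst. Qed.

Lemma rmeas_nth n i : rmeas n (fun s => nth 0 s i).
Proof.
move=> d' T' h mh; have [ni|ni] := ltnP i n.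
  by under eq_fun do rewrite nth_mkseq//; exact: mh.
by under eq_fun do rewrite nth_default ?size_mkseq//; exact: measurable_cst.
Qed.

Lemma rmeas_sum n (k : R -> R) :
  measurable_fun setT k -> rmeas n (fun s => \sum_(x <- s) k x).
Proof.
move=> mk d' T' h mh.
under eq_fun do rewrite /mkseq big_map.
by apply: measurable_sum => i; exact: measurableT_comp.
Qed.

Lemma rmeas_prod n (k : R -> R) :
  measurable_fun setT k -> rmeas n (fun s => \prod_(x <- s) k x).
Proof.
move=> mk d' T' h mh.
under eq_fun do rewrite /mkseq big_map.
by apply: measurable_prod => i _; exact: measurableT_comp.
Qed.

Lemma rmeas_sumM n : rmeas n (@sumM R).
Proof. exact: rmeas_sum. Qed.

Lemma rmeas_sumN n : rmeas n (@sumN R).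
Proof. by apply: rmeas_sum; exact: measurable_funX. Qed.

Lemma rmeasD n F G : rmeas n F -> rmeas n G -> rmeas n (fun s => F s + G s).
Proof.
by move=> mF mG d' T' h mh; apply: measurable_funD; [exact: mF|exact: mG].
Qed.

Lemma rmeasM n F G : rmeas n F -> rmeas n G -> rmeas n (fun s => F s * G s).
Proof.
by move=> mF mG d' T' h mh; apply: measurable_funM; [exact: mF|exact: mG].
Qed.

Lemma rmeas_fun n (k : R -> R) F : measurable_fun setT k -> rmeas n F ->
  rmeas n (fun s => k (F s)).
Proof.
by move=> mk mF d' T' h mh; apply: measurableT_comp => //; exact: mF.
Qed.

Lemma rmeasN n F : rmeas n F -> rmeas n (fun s => - F s).
Proof. by apply: rmeas_fun; exact: oppr_measurable. Qed.

(** The map [k] may depend on the whole list, as in centering or division by the norm; this is why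
    its measurability is tested on an arbitrary measurable function [G] of the list. *)
Lemma rmeas_map n (k : seq R -> R -> R) F :
  (forall G, rmeas n G -> rmeas n (fun s => k s (G s))) ->
  rmeas n F -> rmeas n (fun s => F [seq k s x | x <- s]).
Proof.
move=> mk mF d' T' h mh.
apply: (rmeas_comp _ _ n F) => //.
  by move=> t; rewrite size_map size_mkseq.
move=> i; have [ni|ni] := ltnP i n.
  under eq_fun do rewrite (nth_map 0) ?size_mkseq//.
  exact: (mk _ (rmeas_nth n i) _ _ _ mh).
rewrite (_ : (fun t => _) = cst 0); first exact: measurable_cst.
by apply/funext => t; rewrite nth_default// size_map size_mkseq.
Qed.

Lemma measurable_sqrt : measurable_fun setT (@Num.sqrt R).
Proof. by apply: continuous_measurable_fun; exact: sqrt_continuous. Qed.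

(** The inverse is not continuous at 0; the real power with exponent -1 is measurable and agrees
    with it on nonnegative numbers, including at 0. *)
Lemma measurable_invsqrt : measurable_fun setT (fun x : R => (Num.sqrt x)^-1).
Proof.
rewrite (_ : (fun x => _) = (fun x : R => (Num.sqrt x) `^ (-1))).
  apply: (measurableT_comp (f := fun y : R => y `^ (-1))) => //.
  exact: measurable_sqrt.
by apply/funext => x; rewrite powR_inv1// sqrtr_ge0.
Qed.

End measurability.

(** * The zero-sum hyperplane, and the splitting of a vector into mean and centred part *)

Section hyperplane.
Context {R : realType}.
Local Notation mu := (@lebesgue_measure R).
Implicit Types (u s : seq R) (H F : seq R -> R).

(** The chart of the zero-sum hyperplane by its first coordinates, that is [hyp_emb] for m = 0. *)
Definition emb u : seq R := rcons u (- sumM u).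
Definition mean s : R := sumM s / (size s)%:R.
Definition centered s : seq R := [seq x - mean s | x <- s].

Lemma sumN_ge0 s : 0 <= sumN s.
Proof. by apply: sumr_ge0 => x _; exact: sqr_ge0. Qed.

Lemma sumM_rcons s (x : R) : sumM (rcons s x) = sumM s + x.
Proof. by rewrite /sumM -cats1 big_cat big_seq1. Qed.

Lemma sumM_emb u : sumM (emb u) = 0.
Proof. by rewrite sumM_rcons subrr. Qed.

Lemma size_emb u : size (emb u) = (size u).+1.
Proof. by rewrite size_rcons. Qed.

Lemma sumM_affine (a b : R) s :
  sumM [seq a * x + b | x <- s] = a * sumM s + (size s)%:R * b.
Proof.
rewrite /sumM big_map big_split/= mulr_sumr; congr (_ + _).
by rewrite big_const_seq count_predT iter_addr_0 mulr_natl.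
Qed.

Lemma sumM_scale (a : R) s : sumM [seq a * x | x <- s] = a * sumM s.
Proof. by rewrite /sumM big_map mulr_sumr. Qed.

Lemma sumN_scale (a : R) s : sumN [seq a * x | x <- s] = a ^+ 2 * sumN s.
Proof. by rewrite /sumN big_map mulr_sumr; apply: eq_bigr => x _; rewrite exprMn. Qed.

Lemma sumN_shift (b : R) s :
  sumN [seq b + x | x <- s] =
  (size s)%:R * b ^+ 2 + 2 * b * sumM s + sumN s.
Proof.
rewrite /sumN /sumM big_map.
under eq_bigr do rewrite sqrrD.
rewrite 2!big_split/=; congr (_ + _ + _).
  by rewrite big_const_seq count_predT iter_addr_0 mulr_natl.
by rewrite mulr_sumr; apply: eq_bigr => x _; rewrite -mulr_natl mulrA.
Qed.

Lemma emb_scale (a : R) u : emb [seq a * x | x <- u] = [seq a * x | x <- emb u].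
Proof. by rewrite /emb map_rcons sumM_scale mulrN. Qed.

Lemma centered_shift (b : R) s : (0 < size s)%N -> sumM s = 0 ->
  centered [seq b + x | x <- s] = s.
Proof.
move=> s0 Ms; rewrite /centered -map_comp -[RHS]map_id; apply: eq_map => x /=.
rewrite /mean size_map (_ : sumM _ = (size s)%:R * b).
  by rewrite mulrC mulKf ?pnatr_eq0 -?lt0n// addrAC subrr add0r.
rewrite (_ : [seq b + x | x <- s] = [seq 1 * x + b | x <- s]).
  by rewrite sumM_affine Ms mulr0 add0r.
by apply: eq_map => y; rewrite mul1r addrC.
Qed.

Lemma emb_measurable d (T : measurableType d) n (h : nat -> T -> R) i :
  (forall j, measurable_fun setT (h j)) ->
  measurable_fun setT (fun t => nth 0 (emb (mkseq (h ^~ t) n)) i).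
Proof.
move=> mh; under eq_fun do rewrite /emb nth_rcons size_mkseq.
case: (i < n)%N; first exact: rmeas_nth.
case: (i == n); last exact: measurable_cst.
by apply: measurable_funN; exact: rmeas_sumM.
Qed.

Lemma rmeas_emb n F : rmeas n.+1 F -> rmeas n (fun u => F (emb u)).
Proof.
move=> mF d' T' h mh; apply: (rmeas_comp _ _ n.+1 F) => //.
  by move=> t; rewrite size_emb size_mkseq.
by move=> i; exact: emb_measurable.
Qed.

(* The last coordinate is replaced by the mean [s], for fixed first [n] ones;
   these are then translated by [s], so no Jacobian beyond [n.+1] appears. *)
Lemma iint_mean n (g : seq R -> \bar R) :
  (forall s, (0 <= g s)%E) -> emeas n.+1 g ->
  (iint n.+1 g = n.+1%:R%:E *
     \int[mu]_s iint n (fun u => g [seq (s + x)%R | x <- emb u]))%E.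
Proof.
move=> g0 mg; rewrite iint_rcons.
pose G (r : R) y := g (rcons y (n.+1%:R * r - sumM y)).
have mG : pmeas n G.
  move=> d' T' p h mp mh; apply: (emeas_comp _ _ n.+1) => //.
    by move=> t; rewrite size_rcons size_mkseq.
  move=> i; under eq_fun do rewrite nth_rcons size_mkseq.
  case: (i < n)%N; first exact: rmeas_nth.
  case: (i == n); last exact: measurable_cst.
  apply: measurable_funB; last exact: rmeas_sumM.
  exact: measurable_funM.
have -> : (iint n (fun y => \int[mu]_t g (rcons y t)) =
           iint n (fun y => n.+1%:R%:E * \int[mu]_s G s y))%E.
  apply: eq_iint => y sy; rewrite (ge0_integral_affine n.+1%:R (- sumM y))//.
  apply: (emeas_comp _ _ n.+1) => //; first by move=> t; rewrite size_rcons sy.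
  move=> i; under eq_fun do rewrite nth_rcons sy.
  case: (i < n)%N; first exact: measurable_cst.
  by case: (i == n); [exact: measurable_id|exact: measurable_cst].
rewrite iintZl//; last 2 first.
- by move=> y; apply: integral_ge0 => x _; exact: g0.
- by apply: (pmeas_integral _ G) => // x y; exact: g0.
rewrite -(iint_tonelli n G)//; last by move=> x y; exact: g0.
congr (_ * _)%E; apply: eq_integral => s _.
rewrite (iint_affine _ 1 s)//; last 2 first.
- by move=> y; exact: g0.
- exact: pmeas_emeas.
rewrite expr1n mul1e; apply: eq_iint => u su; congr g.
rewrite /emb map_rcons; congr rcons; first by apply: eq_map => x; rewrite mul1r addrC.
by rewrite sumM_affine su; ring.
Qed.

End hyperplane.

(** * Gaussian expectation *)

Section gaussian.
Context {R : realType}.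
Local Notation mu := (@lebesgue_measure R).
Implicit Types (u s : seq R) (H F : seq R -> R).

Definition std_pdf : R -> R := normal_pdf 0 1.
Definition peak : R := normal_peak 1.
Definition gweight s : R := \prod_(x <- s) std_pdf x.
Definition gexp (n : nat) F : \bar R := iint n (fun s => (F s * gweight s)%:E).

Lemma peak_gt0 : 0 < peak.
Proof. by rewrite normal_peak_gt0// oner_neq0. Qed.

Lemma std_pdfE x : std_pdf x = peak * expR (- (x ^+ 2 / 2)).
Proof.
rewrite /std_pdf normal_pdfE ?oner_neq0// /normal_fun; congr (_ * expR _).
by rewrite subr0 expr1n mulNr.
Qed.

Lemma std_pdf_ge0 x : 0 <= std_pdf x.
Proof. exact: normal_pdf_ge0. Qed.

Lemma measurable_std_pdf : measurable_fun setT std_pdf.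
Proof. exact: measurable_normal_pdf. Qed.

Lemma integral_std_pdf : (\int[mu]_x (std_pdf x)%:E = 1)%E.
Proof. exact: integral_normal_pdf. Qed.

Lemma gweight_ge0 s : 0 <= gweight s.
Proof. by apply: prodr_ge0 => x _; exact: std_pdf_ge0. Qed.

Lemma rmeas_gweight n : rmeas n gweight.
Proof. by apply: rmeas_prod; exact: measurable_std_pdf. Qed.

Lemma gweightE s : gweight s = peak ^+ size s * expR (- (sumN s / 2)).
Proof.
rewrite /gweight; under eq_bigr do rewrite std_pdfE.
rewrite big_split/= -expR_sum big_const_seq count_predT iter_mulr_1.
by congr (_ * expR _); rewrite sumrN /sumN mulr_suml.
Qed.

Lemma gexp_ge0 n F : (forall s, 0 <= F s) -> (0 <= gexp n F)%E.
Proof. by move=> F0; apply: iint_ge0 => s; rewrite lee_fin mulr_ge0// gweight_ge0. Qed.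

Lemma le_gexp n F G : (forall s, 0 <= F s) -> rmeas n F -> rmeas n G ->
  (forall s, 0 <= G s) -> (forall s, size s = n -> F s <= G s) ->
  (gexp n F <= gexp n G)%E.
Proof.
move=> F0 mF mG G0 FG; apply: le_iint => [s|||s|s ss].
- by rewrite lee_fin mulr_ge0// gweight_ge0.
- by apply: rmeas_emeas; apply: rmeasM => //; exact: rmeas_gweight.
- by apply: rmeas_emeas; apply: rmeasM => //; exact: rmeas_gweight.
- by rewrite lee_fin mulr_ge0// gweight_ge0.
- by rewrite lee_fin ler_wpM2r ?gweight_ge0// FG.
Qed.

Lemma eq_gexp n F G : (forall s, size s = n -> F s = G s) -> gexp n F = gexp n G.
Proof. by move=> FG; apply: eq_iint => s ss; rewrite FG. Qed.

Lemma gexpD n F G : (forall s, 0 <= F s) -> rmeas n F -> rmeas n G ->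
  (forall s, 0 <= G s) ->
  (gexp n (fun s => F s + G s)%R = gexp n F + gexp n G)%E.
Proof.
move=> F0 mF mG G0; rewrite -iintD.
- by apply: eq_iint => s _; rewrite mulrDl EFinD.
- by move=> s; rewrite lee_fin mulr_ge0// gweight_ge0.
- by move=> s; rewrite lee_fin mulr_ge0// gweight_ge0.
- by apply: rmeas_emeas; apply: rmeasM => //; exact: rmeas_gweight.
- by apply: rmeas_emeas; apply: rmeasM => //; exact: rmeas_gweight.
Qed.

Lemma gexpZ n (k : R) F : 0 <= k -> (forall s, 0 <= F s) -> rmeas n F ->
  (gexp n (fun s => k * F s)%R = k%:E * gexp n F)%E.
Proof.
move=> k0 F0 mF; rewrite -iintZl ?lee_fin//.
- by apply: eq_iint => s _; rewrite -mulrA EFinM.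
- by move=> s; rewrite lee_fin mulr_ge0// gweight_ge0.
- by apply: rmeas_emeas; apply: rmeasM => //; exact: rmeas_gweight.
Qed.

(** Independence of the coordinates under the product weight. The families [h] and [c] are indexed
    by all of [nat] so that the induction can shift them by one. *)
Lemma gexp_prod n (h : nat -> R -> R) (c : nat -> R) :
  (forall i x, 0 <= h i x) -> (forall i, measurable_fun setT (h i)) ->
  (forall i, (\int[mu]_x (h i x * std_pdf x)%:E = (c i)%:E)%E) ->
  gexp n (fun s => \prod_(i < n) h i (nth 0 s i)) = (\prod_(i < n) c i)%:E.
Proof.
elim: n h c => [|n ih] h c h0 mh hc.
  by rewrite /gexp/= /gweight big_nil !big_ord0 mulr1.
rewrite /gexp/= big_ord_recl/= EFinM -hc.
have mhg i : measurable_fun setT (fun x : R => (h i x * std_pdf x)%:E).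
  by apply/measurable_EFinP; apply: measurable_funM => //; exact: measurable_std_pdf.
rewrite muleC -ge0_integralZl//; last 3 first.
- exact: mhg.
- by move=> x _; rewrite lee_fin mulr_ge0// std_pdf_ge0.
- rewrite -(ih (fun i => h i.+1) (fun i => c i.+1))//.
  by apply: gexp_ge0 => s; apply: prodr_ge0.
apply: eq_integral => x _; rewrite muleC.
rewrite -(ih (fun i => h i.+1) (fun i => c i.+1))// /gexp.
rewrite -iintZl; last 3 first.
- by rewrite lee_fin mulr_ge0// std_pdf_ge0.
- by move=> s; rewrite lee_fin mulr_ge0 ?gweight_ge0//; apply: prodr_ge0.
- apply: rmeas_emeas; apply: rmeasM; last exact: rmeas_gweight.
  move=> d' T' k mk; apply: measurable_prod => i _.
  by apply: measurableT_comp => //; exact: rmeas_nth.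
apply: eq_iint => s _; rewrite -EFinM; congr EFin.
by rewrite big_ord_recl/= /gweight big_cons; under eq_bigr do rewrite /=; ring.
Qed.

Lemma gexp1 n : gexp n (fun=> 1) = 1%E.
Proof.
transitivity (gexp n (fun s => \prod_(i < n) 1)).
  by apply: eq_gexp => s _; rewrite big1.
rewrite (gexp_prod n (fun _ _ => 1) (fun=> 1)) ?big1// => i.
by under eq_integral do rewrite mul1r; exact: integral_std_pdf.
Qed.

(** Completing the square: translating x by v makes the exponential factor constant. *)
Lemma integral_std_pdf_expR (v : R) :
  (\int[mu]_x (expR (v * x) * std_pdf x)%:E = (expR (v ^+ 2 / 2))%:E)%E.
Proof.
rewrite (ge0_integral_affine 1 v)//; last 2 first.
- apply/measurable_EFinP; apply: measurable_funM; last exact: measurable_std_pdf.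
  by apply: measurableT_comp => //; exact: mulrl_measurable.
- by move=> x; rewrite lee_fin mulr_ge0 ?expR_ge0// std_pdf_ge0.
rewrite mul1e.
transitivity (\int[mu]_x ((expR (v ^+ 2 / 2))%:E * (std_pdf x)%:E))%E.
  apply: eq_integral => x _; rewrite -EFinM; congr EFin; rewrite !std_pdfE.
  rewrite mulrCA [RHS]mulrCA -!expRD; congr (_ * expR _); lra.
rewrite ge0_integralZl ?integral_std_pdf ?mule1 ?lee_fin ?expR_ge0//.
- by apply/measurable_EFinP; exact: measurable_std_pdf.
- by move=> x _; rewrite lee_fin std_pdf_ge0.
Qed.

(** The product is a multiple of exp (- (v x)^2 / 2), so substituting x / v restores the density.
    With v^2 = 1 - 2 a this is the Laplace transform of the square of a Gaussian. *)
Lemma integral_std_pdf_expR2 (v : R) : 0 < v ->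
  (\int[mu]_x (expR (- ((v ^+ 2 - 1) * (x ^+ 2 / 2))) * std_pdf x)%:E = (v^-1)%:E)%E.
Proof.
move=> v0; rewrite -[RHS]mule1 -integral_std_pdf.
have v'0 : 0 < v^-1 by rewrite invr_gt0.
rewrite (ge0_integral_affine v^-1 0)//; last 2 first.
- apply/measurable_EFinP; apply: measurable_funM; last exact: measurable_std_pdf.
  apply: measurableT_comp => //; apply: measurable_funN; apply: measurable_funM => //.
  by apply: measurable_funM => //; exact: measurable_funX.
- by move=> x; rewrite lee_fin mulr_ge0 ?expR_ge0// std_pdf_ge0.
congr (_ * _)%E; apply: eq_integral => x _; congr EFin; rewrite !std_pdfE.
rewrite mulrCA -expRD; congr (_ * expR _); rewrite addr0; field.
by rewrite gt_eqF.
Qed.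

End gaussian.

(** * Radial weights on the hyperplane of zero-sum vectors *)

Section radial.
Context {R : realType}.
Local Notation mu := (@lebesgue_measure R).
Implicit Types (u s : seq R) (H F : seq R -> R).

(** Both integrals use Lebesgue measure in the chart [emb] but the Euclidean norm of the hyperplane;
    the constant Jacobian of the chart is left out, as it cancels later. *)
Definition plane_gauss (n : nat) H : \bar R :=
  iint n (fun u => (H (emb u) * expR (- (sumN (emb u) / 2)))%:E).

Definition plane_ball (n : nat) (q : R) H : \bar R :=
  iint n (fun u => (if sumN (emb u) < q then H (emb u) else 0)%:E).

Definition homog0 H := forall (a : R) s, 0 < a -> H [seq a * x | x <- s] = H s.

Lemma rmeas_sumN_emb n : rmeas n (fun u => sumN (emb u)).
Proof. by apply: rmeas_emb; exact: rmeas_sumN. Qed.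

Lemma rmeas_mean n : rmeas n (@mean R).
Proof.
move=> d' T' h mh; rewrite /mean; under eq_fun do rewrite size_mkseq.
by apply: measurable_funM => //; exact: rmeas_sumM.
Qed.

Lemma rmeas_center n F : rmeas n F -> rmeas n (fun s => F (centered s)).
Proof.
apply: (rmeas_map n (fun s x => x - mean s)) => G mG.
by apply: rmeasD => //; apply: rmeasN; exact: rmeas_mean.
Qed.

Lemma rmeas_expR n F : rmeas n F -> rmeas n (fun s => expR (F s)).
Proof. by apply: rmeas_fun; exact: measurable_expR. Qed.

Lemma rmeas_gauss n (c : R) :
  rmeas n (fun s => expR (- (c * sumN s))).
Proof.
by apply: rmeas_expR; apply: rmeasN; apply: rmeasM;
  [exact: rmeas_cst|exact: rmeas_sumN].
Qed.

Lemma plane_gauss_integrand n H : rmeas n.+1 H ->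
  rmeas n (fun u => H (emb u) * expR (- (sumN (emb u) / 2))).
Proof.
move=> mH; apply: (rmeas_emb n (fun s => H s * expR (- (sumN s / 2)))).
apply: rmeasM => //; rewrite (_ : (fun s => _) = (fun s => expR (- (2^-1 * sumN s)))).
  exact: rmeas_gauss.
by apply/funext => s; rewrite mulrC.
Qed.

(** Since |s|^2 = N (mean s)^2 + |centered s|^2, the Gaussian weight factors and the mean integrates
    out into [c]. Its finiteness is settled later by evaluating at the constant function 1. *)
Lemma gexp_center n : exists2 c : \bar R, (0 <= c)%E &
  forall H, (forall s, 0 <= H s) -> rmeas n.+1 H ->
  gexp n.+1 (fun s => H (centered s)) = (c * plane_gauss n H)%E.
Proof.
pose w (t : R) := peak ^+ n.+1 * expR (- (n.+1%:R * t ^+ 2 / 2)).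
have w0 t : 0 <= w t by rewrite mulr_ge0 ?expR_ge0// exprn_ge0// ltW// peak_gt0.
have mw : measurable_fun setT w.
  apply: measurable_funM => //; apply: measurableT_comp => //.
  apply: measurable_funN; apply: measurable_funM => //.
  by apply: measurable_funM => //; exact: measurable_funX.
exists (n.+1%:R%:E * \int[mu]_t (w t)%:E)%E.
  by apply: mule_ge0 => //; apply: integral_ge0 => t _; rewrite lee_fin.
move=> H H0 mH.
have HE0 s : 0 <= H s * expR (- (sumN s / 2)) by rewrite mulr_ge0 ?expR_ge0.
rewrite /gexp iint_mean; last 2 first.
- by move=> s; rewrite lee_fin mulr_ge0// gweight_ge0.
- by apply: rmeas_emeas; apply: rmeasM; [exact: rmeas_center|exact: rmeas_gweight].
rewrite -muleA; congr (_ * _)%E.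
rewrite muleC -ge0_integralZl//; last 3 first.
- by apply/measurable_EFinP.
- by move=> t _; rewrite lee_fin.
- by apply: iint_ge0 => u; rewrite lee_fin.
apply: eq_integral => t _; rewrite muleC -iintZl ?lee_fin//; last first.
  by apply: rmeas_emeas; exact: plane_gauss_integrand.
  by move=> u; rewrite lee_fin.
apply: eq_iint => u su; rewrite -EFinM; congr EFin.
rewrite centered_shift ?size_emb ?sumM_emb// gweightE size_map size_emb su.
rewrite sumN_shift sumM_emb size_emb su /w mulr0 addr0.
rewrite mulrDl opprD expRD; ring.
Qed.

Lemma plane_gauss_scale n H (a : R) : 0 < a ->
  (forall s, 0 <= H s) -> rmeas n.+1 H -> homog0 H ->
  plane_gauss n H = ((a ^+ n)%:E * plane_gauss n (fun s =>
    (H s * expR (- ((a ^+ 2 - 1) * sumN s / 2)))%R))%E.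
Proof.
move=> a0 H0 mH hH; rewrite /plane_gauss (iint_affine n a 0)//; last 2 first.
- by move=> s; rewrite lee_fin mulr_ge0 ?expR_ge0.
- by apply: rmeas_emeas; exact: plane_gauss_integrand.
congr (_ * _)%E; apply: eq_iint => u _; congr EFin.
under eq_map do rewrite addr0.
rewrite emb_scale hH// sumN_scale -[RHS]mulrA -expRD; congr (_ * expR _); lra.
Qed.

(** Dilating the hyperplane by a leaves [H] unchanged and turns the Gaussian weight into one of
    another width. The factor of [gexp_center] stands on both sides, so the identity passes to the
    Gaussian vector. *)
Lemma gexp_center_scale n H (a : R) : 0 < a ->
  (forall s, 0 <= H s) -> rmeas n.+1 H -> homog0 H ->
  gexp n.+1 (fun s => H (centered s)) = ((a ^+ n)%:E * gexp n.+1 (fun s =>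
    (H (centered s) * expR (- ((a ^+ 2 - 1) * sumN (centered s) / 2)))%R))%E.
Proof.
move=> a0 H0 mH hH; have [c c0 E] := gexp_center n.
pose H' s := H s * expR (- ((a ^+ 2 - 1) * sumN s / 2)).
rewrite E// (E H'); last 2 first.
- by move=> s; rewrite mulr_ge0 ?expR_ge0.
- apply: rmeasM => //; rewrite (_ : (fun s => _) =
    (fun s => expR (- (((a ^+ 2 - 1) / 2) * sumN s)))); first exact: rmeas_gauss.
  by apply/funext => s; congr (expR (- _)); ring.
by rewrite (plane_gauss_scale n H a)// muleCA.
Qed.

Lemma plane_ball_integrand n q H : rmeas n.+1 H ->
  rmeas n (fun u => if sumN (emb u) < q then H (emb u) else 0).
Proof.
move=> mH d' T' h mh; apply: measurable_fun_ifT.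
- by apply: measurable_fun_ltr => //; exact: rmeas_sumN_emb.
- exact: (rmeas_emb _ _ mH _ _ _ mh).
- exact: measurable_cst.
Qed.

Lemma plane_ball_scale n q H : 0 < q ->
  (forall s, 0 <= H s) -> rmeas n.+1 H -> homog0 H ->
  plane_ball n q H = ((Num.sqrt q ^+ n)%:E * plane_ball n 1 H)%E.
Proof.
move=> q0 H0 mH hH; rewrite /plane_ball (iint_affine n (Num.sqrt q) 0)//; last 3 first.
- by rewrite sqrtr_gt0.
- by move=> s; rewrite lee_fin; case: ifP.
- by apply: rmeas_emeas; exact: plane_ball_integrand.
congr (_ * _)%E; apply: eq_iint => u _; congr EFin.
under eq_map do rewrite addr0.
rewrite emb_scale hH ?sqrtr_gt0// sumN_scale sqr_sqrtr ?ltW//.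
by rewrite -[X in _ < X]mulr1 ltr_pM2l// mulr1.
Qed.

(** The layer-cake kernel: integrated over x it is proportional to exp (- y), while for fixed x it
    is a multiple of the indicator of y < x. *)
Definition expw (y x : R) : R := if y < x then expR (- x) else 0.

Lemma expw_ge0 y x : 0 <= expw y x.
Proof. by rewrite /expw; case: ifP => // _; exact: expR_ge0. Qed.

Lemma measurable_expRN : measurable_fun setT (fun x : R => expR (- x)).
Proof. by apply: measurableT_comp => //; exact: measurable_funN. Qed.

Lemma measurable_expw y : measurable_fun setT (expw y).
Proof.
apply: measurable_fun_ifT => //; first exact: measurable_fun_ltr.
exact: measurable_expRN.
Qed.

Lemma integral_expw (y : R) :
  (\int[mu]_x (expw y x)%:E = (expR (- y))%:E * \int[mu]_x (expw 0 x)%:E)%E.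
Proof.
rewrite (ge0_integral_affine 1 y)//; last 2 first.
- by apply/measurable_EFinP; exact: measurable_expw.
- by move=> x; rewrite lee_fin expw_ge0.
rewrite mul1e -ge0_integralZl//; last 2 first.
- by apply/measurable_EFinP; exact: measurable_expw.
- by move=> x _; rewrite lee_fin expw_ge0.
apply: eq_integral => x _; rewrite -EFinM; congr EFin.
rewrite /expw mul1r ltrDr; case: ifP => _; last by rewrite mulr0.
by rewrite -expRD opprD addrC.
Qed.

(** The upper bound 1 is comparison with the exponential density. For the lower bound exp (-1),
    translating by 1 moves the jump away from the support of that density, where the comparison then
    holds pointwise. *)
Lemma integral_expw0 : exists2 k : R, 0 < k & (\int[mu]_x (expw 0 x)%:E = k%:E)%E.
Proof.
set I := (\int[mu]_x _)%E.
have mepdf : measurable_fun setT (fun x : R => (exponential_pdf 1 x)%:E).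
  by apply/measurable_EFinP; exact: measurable_exponential_pdf.
have I1 : (I <= 1)%E.
  rewrite -(integral_exponential_pdf (@ltr01 R)); apply: ge0_le_integral => //.
  - by move=> x _; rewrite lee_fin expw_ge0.
  - by apply/measurable_EFinP; exact: measurable_expw.
  - move=> x _; rewrite lee_fin /expw; case: ifPn => x0; last exact: exponential_pdf_ge0.
    by rewrite exponential_pdfE ?(ltW x0)// mul1r mulN1r.
have I0 : ((expR (-1))%:E <= I)%E.
  rewrite -[leLHS]mule1 -(integral_exponential_pdf (@ltr01 R)) /I.
  rewrite (ge0_integral_affine 1 1 (fun x => (expw 0 x)%:E))//; last 2 first.
  - by apply/measurable_EFinP; exact: measurable_expw.
  - by move=> x; rewrite lee_fin expw_ge0.
  rewrite mul1e -ge0_integralZl//; last first.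
    by move=> x _; rewrite lee_fin exponential_pdf_ge0.
  apply: ge0_le_integral => //.
  - by move=> x _; rewrite -EFinM lee_fin mulr_ge0 ?expR_ge0// exponential_pdf_ge0.
  - apply: emeasurable_funM => //.
  - apply/measurable_EFinP; apply: (measurableT_comp (measurable_expw 0)).
    by apply: measurable_funD => //; exact: measurable_funM.
  - move=> x _; rewrite -EFinM lee_fin; have [x0|x0] := ltP x 0.
      by rewrite lt0_exponential_pdf// mulr0 expw_ge0.
    rewrite exponential_pdfE// /expw mul1r mul1r ifT; last by rewrite ltr_pwDr.
    by rewrite -expRD ler_expR; lra.
have I00 : (0 < I)%E by apply: lt_le_trans I0; rewrite lte_fin expR_gt0.
exists (fine I); first by apply: fine_gt0; rewrite I00/= (le_lt_trans I1)// ltry.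
by rewrite fineK// ge0_fin_numE ?ltW// (le_lt_trans I1)// ltry.
Qed.

(* Layer cake: [exp (- |x|^2 / 2)] is proportional to the integral of [exp (- t)]
   over the [t] with [|x|^2 < 2 t]; each of these balls scales to the unit ball. *)
Lemma plane_gauss_ball n : exists k : R, exists2 c : \bar R, 0 < k /\ (0 <= c)%E &
  forall H, (forall s, 0 <= H s) -> rmeas n.+1 H -> homog0 H ->
  (k%:E * plane_gauss n H = c * plane_ball n 1 H)%E.
Proof.
have [k k0 Ik] := integral_expw0; exists k.
pose w (t : R) := expw 0 t * Num.sqrt (2 * t) ^+ n.
have w0 t : 0 <= w t by rewrite mulr_ge0 ?expw_ge0// exprn_ge0// sqrtr_ge0.
have mw : measurable_fun setT w.
  apply: measurable_funM; first exact: measurable_expw.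
  apply: measurable_funX; apply: measurableT_comp; first exact: measurable_sqrt.
  exact: measurable_funM.
exists (\int[mu]_t (w t)%:E)%E.
  by split=> //; apply: integral_ge0 => t _; rewrite lee_fin.
move=> H H0 mH hH.
pose G t u := (expw (sumN (emb u) / 2) t * H (emb u))%:E.
have G0 t u : (0 <= G t u)%E by rewrite lee_fin mulr_ge0// expw_ge0.
have mG : pmeas n G.
  move=> d' T' p h mp mh; apply/measurable_EFinP; apply: measurable_funM.
    apply: measurable_fun_ifT => //.
    - apply: measurable_fun_ltr => //; apply: measurable_funM => //.
      exact: rmeas_sumN_emb.
    - exact: (measurableT_comp measurable_expRN mp).
  exact: (rmeas_emb _ _ mH _ _ _ mh).
transitivity (iint n (fun u => \int[mu]_t G t u))%E.
  rewrite -iintZl ?lee_fin ?ltW//; last 2 first.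
  - by move=> u; rewrite lee_fin mulr_ge0 ?expR_ge0.
  - by apply: rmeas_emeas; exact: plane_gauss_integrand.
  apply: eq_iint => u _; rewrite /G.
  under eq_integral do rewrite mulrC EFinM.
  rewrite ge0_integralZl ?lee_fin//; last 2 first.
  - by apply/measurable_EFinP; exact: measurable_expw.
  - by move=> x _; rewrite lee_fin expw_ge0.
  by rewrite integral_expw Ik -!EFinM; congr EFin; ring.
rewrite -(iint_tonelli n G)// muleC -ge0_integralZl//; last 3 first.
- exact/measurable_EFinP.
- by move=> t _; rewrite lee_fin.
- by apply: iint_ge0 => u; rewrite lee_fin; case: ifP.
apply: eq_integral => t _; rewrite muleC /w.
have [t0|t0] := ltP 0 t.
  rewrite EFinM -muleA -plane_ball_scale ?mulr_gt0// -iintZl; last 3 first.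
  - by rewrite lee_fin expw_ge0.
  - by move=> u; rewrite lee_fin; case: ifP.
  - by apply: rmeas_emeas; exact: plane_ball_integrand.
  apply: eq_iint => u _; rewrite /G /expw t0 -EFinM; congr EFin.
  rewrite ltr_pdivrMr// mulrC [t * 2]mulrC; case: ifP => _; first by rewrite mulrC.
  by rewrite !mulr0.
(* For t <= 0 both sides vanish, because the kernel requires |v|^2 / 2 < t. *)
have -> : expw 0 t = 0 by rewrite /expw ltNge t0.
rewrite mul0r mul0e -(mul0e (iint n (G t))) -iintZl//; last exact: pmeas_emeas.
apply: eq_iint => u _; rewrite mul0e /G /expw ltNge (_ : t <= _) ?mul0r//.
by apply: (le_trans t0); rewrite divr_ge0// sumN_ge0.
Qed.

(** Two proportionalities are chained. At the constant function 1 they read c P = 1 and k P = C B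
    with nonnegative extended reals, which forces c, P and C to be positive and finite. *)
Lemma plane_ball_gexp n : exists2 b : R, 0 < b &
  forall H, (forall s, 0 <= H s) -> rmeas n.+1 H -> homog0 H ->
  (plane_ball n 1 H = b%:E * gexp n.+1 (fun s => H (centered s)))%E.
Proof.
have [c c0 Ec] := gexp_center n.
have [k [C [k0 C0] Ek]] := plane_gauss_ball n.
have h1 : homog0 (fun=> 1) by [].
have m1 := rmeas_cst n.+1 (1 : R).
have := Ec (fun=> 1) (fun=> ler01) m1; have := Ek (fun=> 1) (fun=> ler01) m1 h1.
rewrite gexp1.
set P := plane_gauss n _; set B := plane_ball n 1 _ => kP cP.
have P0 : (0 <= P)%E by apply: iint_ge0 => u; rewrite lee_fin mul1r expR_ge0.
have B0 : (0 <= B)%E by apply: iint_ge0 => u; rewrite lee_fin; case: ifP.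
have {}[cr [pr [cr0 pr0 cE PE]]] : exists cr pr : R,
    [/\ 0 < cr, 0 < pr, c = cr%:E & P = pr%:E].
  move: c c0 P P0 kP cP {Ec} => [c||]// c0 [p||]// p0 kP.
  - move=> [cp]; exists c, p; rewrite !lee_fin in c0 p0.
    by split=> //; rewrite lt_neqAle ?c0 ?p0 andbT; apply/eqP => e;
      move: cp; rewrite -e ?mul0r ?mulr0 => /eqP; rewrite oner_eq0.
  - rewrite lee_fin le_eqVlt in c0; case/orP: c0 => [/eqP <-|c0].
      by rewrite mul0e => -[/eqP]; rewrite oner_eq0.
    by rewrite gt0_muley ?lte_fin.
  - rewrite lee_fin le_eqVlt in p0; case/orP: p0 => [/eqP <-|p0].
      by rewrite mule0 => -[/eqP]; rewrite oner_eq0.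
    by rewrite gt0_mulye ?lte_fin.
rewrite {}PE {}cE in kP cP Ec *.
have kp0 : 0 < k * pr by rewrite mulr_gt0.
have [Cr Cr0 CE] : exists2 Cr : R, 0 < Cr & C = Cr%:E.
  move: C C0 B B0 kP {Ek} => [C||]// C0 [b||]// b0.
  - move=> [e]; exists C => //; rewrite lee_fin in C0.
    by rewrite lt_neqAle C0 andbT; apply/eqP => C00; move: kp0; rewrite e -C00 mul0r ltxx.
  - rewrite lee_fin le_eqVlt in C0; case/orP: C0 => [/eqP <-|C0].
      by rewrite mul0e => -[e]; move: kp0; rewrite e ltxx.
    by rewrite gt0_muley ?lte_fin.
  - rewrite lee_fin le_eqVlt in b0; case/orP: b0 => [/eqP <-|b0].
      by rewrite mule0 => -[e]; move: kp0; rewrite e ltxx.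
    by rewrite gt0_mulye ?lte_fin.
exists (k / (Cr * cr)); first by rewrite divr_gt0// mulr_gt0.
move=> H H0 mH hH; rewrite Ec// muleA.
have -> : ((k / (Cr * cr))%:E * cr%:E = Cr^-1%:E * k%:E)%E.
  by rewrite -!EFinM; congr EFin; field; rewrite !gt_eqF.
by rewrite -muleA Ek// CE muleA -EFinM mulVf ?mul1e// gt_eqF.
Qed.

End radial.

(** * The two ensembles as Gaussian expectations *)

Section ensembles.
Context {R : realType}.
Implicit Types (u s : seq R) (F G : seq R -> R).

(** The radial projection for vectors already translated to the origin. Division by zero sends the
    zero vector to the constant list m, consistently with homogeneity of degree 0. *)
Definition sphere_map (m r : R) s : seq R :=
  [seq m + r * (y / Num.sqrt (sumN s)) | y <- s].

Lemma sphere_map_homog0 (m r : R) F : homog0 (fun s => F (sphere_map m r s)).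
Proof.
move=> a s a0; congr F; rewrite /sphere_map -map_comp; apply: eq_map => y /=.
rewrite sumN_scale sqrtrM ?sqr_ge0// sqrtr_sqr gtr0_norm//.
by rewrite -mulf_div divff ?mul1r// gt_eqF.
Qed.

Lemma rmeas_sphere_map n (m r : R) F :
  rmeas n F -> rmeas n (fun s => F (sphere_map m r s)).
Proof.
apply: (rmeas_map n (fun s y => m + r * (y / Num.sqrt (sumN s)))) => G mG.
apply: rmeasD; first exact: rmeas_cst.
apply: rmeasM; first exact: rmeas_cst.
apply: rmeasM => //; apply: (rmeas_fun n (fun x => (Num.sqrt x)^-1)).
  exact: measurable_invsqrt.
exact: rmeas_sumN.
Qed.

Lemma hyp_emb_shift (m : R) n u : size u = n ->
  hyp_emb m n.+1 [seq 1 * x + m | x <- u] = [seq m + x | x <- emb u].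
Proof.
move=> su; rewrite /hyp_emb /emb map_rcons sumM_affine su; congr rcons.
  by apply: eq_map => x; rewrite mul1r addrC.
ring.
Qed.

Lemma radial_proj_shift (m r : R) s :
  radial_proj m r [seq m + x | x <- s] = sphere_map m r s.
Proof.
rewrite /radial_proj (_ : [seq x - m | x <- [seq m + x | x <- s]] = s)//.
by rewrite -map_comp -[RHS]map_id; apply: eq_map => x /=; rewrite addrC addKr.
Qed.

Lemma hyp_emb_measurable d (T : measurableType d) (m : R) n (h : nat -> T -> R) i :
  (forall j, measurable_fun setT (h j)) ->
  measurable_fun setT (fun t => nth 0 (hyp_emb m n.+1 (mkseq (h ^~ t) n)) i).
Proof.
move=> mh; under eq_fun do rewrite nth_rcons size_mkseq.
case: (i < n)%N; first exact: rmeas_nth.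
case: (i == n); last exact: measurable_cst.
by apply: measurable_funB; [exact: measurable_cst|exact: rmeas_sumM].
Qed.

Lemma rmeas_radial_proj n (m r : R) F :
  rmeas n F -> rmeas n (fun s => F (radial_proj m r s)).
Proof.
move=> mF; have mG : rmeas n (fun s => F (sphere_map m r [seq x - m | x <- s])).
  apply: (rmeas_map n (fun=> fun x => x - m) (fun s => F (sphere_map m r s))).
    by move=> G mG; apply: rmeasD => //; exact: rmeas_cst.
  exact: rmeas_sphere_map.
exact: mG.
Qed.

(** For zero-sum v, |m + v|^2 < rho N means |v|^2 < N (rho - m^2), so translating by m gives a
    centred ball of radius r, which scales to the unit ball. The factor r^n b does not depend on [G]
    and cancels in [mc_expect]. *)
Lemma mc_integral n : exists2 b : R, 0 < b & forall (m rho : R) G,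
  0 < rho - m ^+ 2 -> (forall s, 0 <= G s) -> rmeas n.+1 G ->
  let r := Num.sqrt (n.+1%:R * (rho - m ^+ 2)) in
  (iint n (fun psi => if in_ball m rho n.+1 psi
     then (G (radial_proj m r (hyp_emb m n.+1 psi)))%:E else 0%E) =
   (r ^+ n * b)%:E * gexp n.+1 (fun s => G (sphere_map m r (centered s))))%E.
Proof.
have [b b0 Eb] := @plane_ball_gexp R n; exists b => // m rho G v0 G0 mG r.
have q0 : 0 < n.+1%:R * (rho - m ^+ 2) by rewrite mulr_gt0.
rewrite (iint_affine n 1 m)//; last 2 first.
- by move=> s; case: ifP => _; rewrite ?lee_fin.
- rewrite (_ : (fun s => _) = fun s => (if in_ball m rho n.+1 s then
      G (radial_proj m r (hyp_emb m n.+1 s)) else 0)%:E); last first.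
    by apply/funext => s; case: ifP.
  apply: rmeas_emeas => d' T' h mh; apply: measurable_fun_ifT => //.
  + apply: measurable_fun_ltr => //.
    apply: (rmeas_comp _ _ n.+1 (@sumN R)); first exact: rmeas_sumN.
      by move=> t; rewrite size_rcons size_mkseq.
    by move=> i; exact: hyp_emb_measurable.
  + apply: (rmeas_comp _ _ n.+1 (fun s => G (radial_proj m r s))).
    * exact: rmeas_radial_proj.
    * by move=> t; rewrite size_rcons size_mkseq.
    * by move=> i; exact: hyp_emb_measurable.
rewrite expr1n mul1e EFinM -muleA -(Eb (fun s => G (sphere_map m r s)))//; last 2 first.
- exact: rmeas_sphere_map.
- exact: sphere_map_homog0.
rewrite -plane_ball_scale//; last 2 first.
- exact: rmeas_sphere_map.
- exact: sphere_map_homog0.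
apply: eq_iint => u su.
rewrite /in_ball hyp_emb_shift// radial_proj_shift sumN_shift sumM_emb size_emb su.
rewrite mulr0 addr0 (_ : (_ < rho * _) = (sumN (emb u) < n.+1%:R * (rho - m ^+ 2))).
  by case: ifP.
by rewrite mulrBr [rho * _]mulrC ltrBrDl.
Qed.

Lemma maxe_EFin (x : R) : maxe x%:E 0%E = (Num.max x 0)%:E.
Proof. by rewrite EFin_max. Qed.

Lemma rmeas_max0 n F : rmeas n F -> rmeas n (fun s => Num.max (F s) 0).
Proof.
by move=> mF d' T' h mh; apply: measurable_maxr; [exact: mF|exact: measurable_cst].
Qed.

Lemma mc_expectE n (m rho ap an : R) F :
  0 < rho - m ^+ 2 -> rmeas n.+1 F ->
  let r := Num.sqrt (n.+1%:R * (rho - m ^+ 2)) in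
  let T s := sphere_map m r (centered s) in
  gexp n.+1 (fun s => Num.max (F (T s)) 0) = ap%:E ->
  gexp n.+1 (fun s => Num.max (- F (T s)) 0) = an%:E ->
  mc_expect m rho n.+1 F = (ap - an)%:E.
Proof.
move=> v0 mF r T Ep En; have [b b0 Eb] := mc_integral n.
have rb0 : 0 < r ^+ n * b.
  by rewrite mulr_gt0// exprn_gt0// sqrtr_gt0 mulr_gt0.
rewrite /mc_expect /lint/= -/r.
have -> : iint n (fun psi => if in_ball m rho n.+1 psi then 1%E else 0%E) =
    (r ^+ n * b)%:E.
  by rewrite (Eb m rho (fun=> 1))//= ?gexp1 ?mule1//; exact: rmeas_cst.
have mp : rmeas n.+1 (fun s => Num.max (F s) 0) by exact: rmeas_max0.
have mn : rmeas n.+1 (fun s => Num.max (- F s) 0) by apply: rmeas_max0; exact: rmeasN.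
have p0 (x : R) : 0 <= Num.max x 0 by rewrite le_max lexx orbT.
rewrite [X in (X - _)%E](_ : _ = ((r ^+ n * b) * ap)%:E); last first.
  rewrite EFinM -Ep -(Eb m rho (fun s => Num.max (F s) 0))//.
  by apply: eq_iint => psi _; case: ifP => _; rewrite ?maxe_EFin// maxxx.
rewrite [X in (_ - X)%E](_ : _ = ((r ^+ n * b) * an)%:E); last first.
  rewrite EFinM -En -(Eb m rho (fun s => Num.max (- F s) 0))//.
  apply: eq_iint => psi _; case: ifP => _; first by rewrite -EFinN maxe_EFin.
  by rewrite oppe0 maxxx.
rewrite -EFinB -EFinM/= -mulrBr; congr EFin.
by rewrite mulrAC divff ?mul1r// gt_eqF.
Qed.

(** Completing the square: at sqrt v x + m the exponent of the weight is n m^2 / (2 v) - |x|^2 / 2.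
    The first term, the Jacobian and the normalization of the Gaussian density make up the
    constant. *)
Lemma gc_integral n (m v : R) : 0 < v -> exists2 k : R, 0 < k & forall G,
  (forall s, 0 <= G s) -> rmeas n G ->
  (iint n (fun s => (G s * gc_weight (- (m / v)) (1 / (2 * v)) s)%:E) =
   k%:E * gexp n (fun s => G [seq (Num.sqrt v * x + m)%R | x <- s]))%E.
Proof.
move=> v0; set sg := Num.sqrt v; have sg0 : 0 < sg by rewrite sqrtr_gt0.
have sgv : sg ^+ 2 = v by rewrite sqr_sqrtr// ltW.
pose k := expR (n%:R * (m ^+ 2 / (2 * v))).
have pk0 : 0 < @peak R ^+ n by rewrite exprn_gt0// peak_gt0.
exists (sg ^+ n * (k / peak ^+ n)).
  by rewrite mulr_gt0 ?exprn_gt0// divr_gt0// expR_gt0.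
move=> G G0 mG; rewrite (iint_affine n sg m)//; last 2 first.
- by move=> s; rewrite lee_fin mulr_ge0 ?expR_ge0.
- apply: rmeas_emeas; apply: rmeasM => //; apply: rmeas_expR.
  apply: rmeasD; last apply: rmeasN; (apply: rmeasM; first exact: rmeas_cst).
    exact: rmeas_sumM.
  exact: rmeas_sumN.
rewrite EFinM -muleA; congr (_ * _)%E; rewrite -iintZl ?lee_fin; last 3 first.
- by rewrite divr_ge0 ?expR_ge0// ltW.
- by move=> s; rewrite lee_fin mulr_ge0 ?gweight_ge0.
- apply: rmeas_emeas; apply: rmeasM; last exact: rmeas_gweight.
  apply: (rmeas_map n (fun=> fun x => sg * x + m)) => // F mF.
  by apply: rmeasD; [apply: rmeasM => //|]; exact: rmeas_cst.
apply: eq_iint => s ss; rewrite -EFinM; congr EFin.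
rewrite mulrCA; congr (_ * _); rewrite gweightE ss mulrA divfK ?gt_eqF// -expRD.
congr expR; rewrite sumM_affine ss.
have -> : [seq sg * x + m | x <- s] = [seq m + x | x <- [seq sg * x | x <- s]].
  by rewrite -map_comp; apply: eq_map => x /=; rewrite addrC.
rewrite sumN_shift size_map ss sumM_scale sumN_scale sgv.
field; by rewrite gt_eqF.
Qed.

Lemma gc_expectE n (m v ap an : R) F :
  0 < v -> rmeas n F ->
  let T s := [seq Num.sqrt v * x + m | x <- s] in
  gexp n (fun s => Num.max (F (T s)) 0) = ap%:E ->
  gexp n (fun s => Num.max (- F (T s)) 0) = an%:E ->
  gc_expect (- (m / v)) (1 / (2 * v)) n F = (ap - an)%:E.
Proof.
move=> v0 mF T Ep En; have [k k0 Ek] := gc_integral n m v v0.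
rewrite /gc_expect /lint.
have p0 (x : R) : 0 <= Num.max x 0 by rewrite le_max lexx orbT.
set w := gc_weight _ _; have w0 s : 0 <= w s by exact: expR_ge0.
have -> : iint n (fun s => (w s)%:E) = k%:E.
  rewrite -[RHS]mule1 -(gexp1 n) -(Ek (fun=> 1))//.
  by apply: eq_iint => s _; rewrite mul1r.
have mp : rmeas n (fun s => Num.max (F s) 0) by exact: rmeas_max0.
have mn : rmeas n (fun s => Num.max (- F s) 0) by apply: rmeas_max0; exact: rmeasN.
rewrite [X in (X - _)%E](_ : _ = (k * ap)%:E); last first.
  rewrite EFinM -Ep -(Ek (fun s => Num.max (F s) 0))//.
  by apply: eq_iint => s _; rewrite maxe_EFin maxr_pMl// mul0r.
rewrite [X in (_ - X)%E](_ : _ = (k * an)%:E); last first.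
  rewrite EFinM -En -(Ek (fun s => Num.max (- F s) 0))//.
  by apply: eq_iint => s _; rewrite -EFinN maxe_EFin maxr_pMl// mul0r mulNr.
rewrite -EFinB -EFinM/= -mulrBr; congr EFin.
by rewrite mulrAC divff ?mul1r// gt_eqF.
Qed.

End ensembles.

(** * Families with uniformly bounded moments *)

Section tame.
Context {R : realType} {J : Type}.
Variable d : J -> nat.
Implicit Types F G : J -> seq R -> R.

(** The index carries the dimension and the chosen sites, so a single [C] for all i expresses
    uniformity in both. *)
Definition tame F : Prop :=
  (forall i, rmeas (d i) (F i)) /\
  forall p, exists C : R, forall i,
    (gexp (d i) (fun s => `|F i s| ^+ p)%R <= C%:E)%E.

Lemma rmeas_norm n (F : seq R -> R) : rmeas n F -> rmeas n (fun s => `|F s|).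
Proof. by apply: rmeas_fun; exact: normr_measurable. Qed.

Lemma rmeasX n (F : seq R -> R) p : rmeas n F -> rmeas n (fun s => F s ^+ p).
Proof. by apply: (rmeas_fun n (fun x => x ^+ p)); exact: measurable_funX. Qed.

Lemma rmeas_normX n (F : seq R -> R) p : rmeas n F -> rmeas n (fun s => `|F s| ^+ p).
Proof. by move=> mF; apply: rmeasX; exact: rmeas_norm. Qed.

Lemma tame_rmeas F i : tame F -> rmeas (d i) (F i).
Proof. by case. Qed.

Lemma gexp_cst n (c : R) : 0 <= c -> gexp n (fun=> c) = c%:E.
Proof.
move=> c0; rewrite -[RHS]mule1 -(gexp1 n) -gexpZ//.
by apply: eq_gexp => s _; rewrite mulr1.
Qed.

Lemma le_tame F G : (forall i, rmeas (d i) (F i)) -> tame G ->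
  (forall i s, size s = d i -> `|F i s| <= `|G i s|) -> tame F.
Proof.
move=> mF [mG bG] FG; split=> // p; have [C bC] := bG p; exists C => i.
apply: le_trans (bC i); apply: le_gexp => //.
- exact: rmeas_normX.
- exact: rmeas_normX.
- by move=> s ss; apply: lerXn2r; rewrite ?nnegrE// FG.
Qed.

Lemma eq_tame F G : (forall i, rmeas (d i) (F i)) -> tame G ->
  (forall i s, size s = d i -> F i s = G i s) -> tame F.
Proof. by move=> mF tG FG; apply: (le_tame _ _ mF tG) => i s /FG ->. Qed.

Lemma tame_cst (c : R) : tame (fun _ _ => c).
Proof.
split=> [i|p]; first exact: rmeas_cst.
by exists (`|c| ^+ p) => i; rewrite gexp_cst// exprn_ge0.
Qed.

(** The elementary bound (x y)^p <= x^(2p) + y^(2p) takes the place of Cauchy-Schwarz; it costs a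
    doubling of the order, harmless when all moments are bounded. *)
Lemma tameM F G : tame F -> tame G -> tame (fun i s => F i s * G i s).
Proof.
move=> [mF bF] [mG bG]; split=> [i|p]; first exact: rmeasM.
have [C bC] := bF (p * 2)%N; have [D bD] := bG (p * 2)%N.
exists (C + D) => i; rewrite EFinD; apply: le_trans (leeD (bC i) (bD i)).
have X0 (K : seq R -> R) q s : 0 <= `|K s| ^+ q by rewrite exprn_ge0.
rewrite -gexpD//; try exact: rmeas_normX.
apply: le_gexp => //.
- exact/rmeas_normX/rmeasM.
- by apply: rmeasD; exact: rmeas_normX.
- move=> s _; rewrite normrM exprMn !exprM.
  have := sqr_ge0 (`|F i s| ^+ p - `|G i s| ^+ p).
  have := X0 (F i) p s; have := X0 (G i) p s; nra.
Qed.

Lemma tameD F G : tame F -> tame G -> tame (fun i s => F i s + G i s).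
Proof.
move=> [mF bF] [mG bG]; split=> [i|p]; first exact: rmeasD.
have [C bC] := bF p; have [D bD] := bG p.
have X0 (K : seq R -> R) q s : 0 <= `|K s| ^+ q by rewrite exprn_ge0.
exists (2 ^+ p * (C + D)) => i; rewrite EFinM EFinD.
apply: le_trans (lee_wpmul2l _ (leeD (bC i) (bD i))); last first.
  by rewrite lee_fin exprn_ge0.
rewrite -gexpD//; try exact: rmeas_normX.
rewrite -gexpZ ?exprn_ge0//; last by apply: rmeasD; exact: rmeas_normX.
apply: le_gexp => //.
- exact/rmeas_normX/rmeasD.
- apply: rmeasM; first exact: rmeas_cst.
  by apply: rmeasD; exact: rmeas_normX.
- move=> s _; wlog FG : F G {mF mG bF bG C bC D bD} / `|F i s| <= `|G i s|.
    move=> W; have [FG|/ltW GF] := leP `|F i s| `|G i s|; first exact: W.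
    by rewrite [F i s + _]addrC [X in _ * X]addrC; exact: W.
  rewrite (le_trans (_ : _ <= (2 * `|G i s|) ^+ p))//.
    apply: lerXn2r; rewrite ?nnegrE ?mulr_ge0//.
    by rewrite (le_trans (ler_normD _ _))// mulr2n mulrDl mul1r lerD2r.
  by rewrite exprMn ler_wpM2l ?exprn_ge0// lerDr.
Qed.

Lemma tameN F : tame F -> tame (fun i s => - F i s).
Proof.
move=> tF; apply: (le_tame _ F) => // [i|i s _]; last by rewrite normrN.
by apply: rmeasN; exact: tame_rmeas.
Qed.

Lemma tame_sum (K : Type) (r : seq K) (F : K -> J -> seq R -> R) :
  (forall k, tame (F k)) -> tame (fun i s => \sum_(k <- r) F k i s).
Proof.
move=> tF; elim: r => [|k r ih].
  apply: (eq_tame _ _ _ (tame_cst 0)) => [i|i s _]; last by rewrite big_nil.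
  by move=> d' T' h mh; under eq_fun do rewrite big_nil; exact: measurable_cst.
apply: (eq_tame _ _ _ (tameD _ _ (tF k) ih)) => [i|i s _]; last by rewrite big_cons.
by move=> d' T' h mh; apply: measurable_sum => l; exact: (tame_rmeas _ i (tF l)).
Qed.

Lemma rmeas_bigprod (K : eqType) n (r : seq K) (F : K -> seq R -> R) :
  (forall k, rmeas n (F k)) -> rmeas n (fun s => \prod_(k <- r) F k s).
Proof.
by move=> mF d' T' h mh; apply: measurable_prod => l _; exact: mF.
Qed.

Lemma tame_prod (K : eqType) (r : seq K) (F : K -> J -> seq R -> R) :
  (forall k, tame (F k)) -> tame (fun i s => \prod_(k <- r) F k i s).
Proof.
move=> tF; elim: r => [|k r ih].
  apply: (eq_tame _ _ _ (tame_cst 1)) => [i|i s _]; last by rewrite big_nil.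
  by apply: rmeas_bigprod => l; exact: tame_rmeas.
apply: (eq_tame _ _ _ (tameM _ _ (tF k) ih)) => [i|i s _]; last by rewrite big_cons.
by apply: rmeas_bigprod => l; exact: tame_rmeas.
Qed.

(** Telescoping: F P - G Q = (F - G) P + G (P - Q), with the scale [c] attached to the one factor
    that is a difference. *)
Lemma tame_prod_diff (c : J -> R) (K : eqType) (r : seq K)
    (F G : K -> J -> seq R -> R) :
  (forall k, tame (F k)) -> (forall k, tame (G k)) ->
  (forall k, tame (fun i s => c i * (F k i s - G k i s))) ->
  tame (fun i s => c i * (\prod_(k <- r) F k i s - \prod_(k <- r) G k i s)).
Proof.
move=> tF tG tc.
have m r' i : rmeas (d i)
    (fun s => c i * (\prod_(k <- r') F k i s - \prod_(k <- r') G k i s)).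
  apply: rmeasM; first exact: rmeas_cst.
  by apply: rmeasD; last apply: rmeasN; apply: rmeas_bigprod => k; exact: tame_rmeas.
elim: r => [|k r ih].
  by apply: (eq_tame _ _ _ (tame_cst 0)) => // i s _; rewrite !big_nil subrr mulr0.
apply: (eq_tame _ _ _ (tameD _ _ (tameM _ _ (tc k) (tame_prod K r F tF))
  (tameM _ _ (tG k) ih))) => // i s _.
by rewrite !big_cons; ring.
Qed.

Lemma normX_le_expR (x : R) p : `|x| ^+ p <= p`!%:R * (expR x + expR (- x)).
Proof.
have e0 := expR_gt0 x; have e1 := expR_gt0 (- x).
apply: (@le_trans _ _ (p`!%:R * expR `|x|)).
  case: p => [|p]; first by rewrite expr0 fact0 mul1r -expR0 ler_expR.
  rewrite -ler_pdivrMl ?ltr0n ?fact_gt0// mulrC.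
  by have := expR_ge1Dxn p (normr_ge0 x); lra.
apply: ler_wpM2l => //; case: (ger0P x) => _; lra.
Qed.

(** Moments of every order follow from |x|^p <= p! (exp x + exp (- x)). *)
Lemma tame_expR F (C : R) : (forall i, rmeas (d i) (F i)) ->
  (forall i, gexp (d i) (fun s => expR (F i s)) <= C%:E)%E ->
  (forall i, gexp (d i) (fun s => expR (- F i s)) <= C%:E)%E ->
  tame F.
Proof.
move=> mF b1 b2; split=> // p; exists (p`!%:R * (C + C)) => i.
have m1 : rmeas (d i) (fun s => expR (F i s)) by exact: rmeas_expR.
have m2 : rmeas (d i) (fun s => expR (- F i s)) by apply: rmeas_expR; exact: rmeasN.
rewrite EFinM EFinD; apply: le_trans (lee_wpmul2l _ (leeD (b1 i) (b2 i))) => //.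
rewrite -gexpD//.
rewrite -gexpZ//; last exact: rmeasD.
apply: le_gexp => //.
- exact: rmeas_normX.
- by apply: rmeasM; [exact: rmeas_cst|exact: rmeasD].
- by move=> s _; exact: normX_le_expR.
Qed.

Lemma gexp_expR_lin n (v : nat -> R) :
  gexp n (fun s => expR (\sum_(j < n) v j * nth 0 s j)) =
  (expR (\sum_(j < n) v j ^+ 2 / 2))%:E.
Proof.
rewrite expR_sum -(gexp_prod n (fun j x => expR (v j * x))
  (fun j => expR (v j ^+ 2 / 2))).
- by apply: eq_gexp => s _; rewrite expR_sum.
- by move=> j x; exact: expR_ge0.
- by move=> j; apply: measurableT_comp => //; exact: mulrl_measurable.
- by move=> j; exact: integral_std_pdf_expR.
Qed.

(** A linear form of variance at most 1 has both exponential moments bounded by exp (1/2).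
    Coordinates and normalized sums are the two cases used. *)
Lemma tame_lin (v : J -> nat -> R) :
  (forall i, \sum_(j < d i) v i j ^+ 2 <= 1) ->
  tame (fun i s => \sum_(j < d i) v i j * nth 0 s j).
Proof.
move=> v1; apply: (tame_expR _ (expR (2^-1))) => i.
- move=> d' T' h mh; apply: measurable_sum => j; apply: measurable_funM => //.
  exact: rmeas_nth.
- by rewrite gexp_expR_lin lee_fin ler_expR -mulr_suml ler_pdivrMr// mulVf.
- rewrite (eq_gexp _ _ (fun s => expR (\sum_(j < d i) - v i j * nth 0 s j))).
    rewrite (gexp_expR_lin _ (fun j => - v i j)) lee_fin ler_expR -mulr_suml.
    by under eq_bigr do rewrite sqrrN; rewrite ler_pdivrMr// mulVf.
  by move=> s _; under [in RHS]eq_bigr do rewrite mulNr; rewrite sumrN.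
Qed.

Lemma tame_nth (k : J -> nat) : (forall i, k i < d i)%N ->
  tame (fun i s => nth 0 s (k i)).
Proof.
move=> kd; apply: (eq_tame _ _ _ (tame_lin (fun i j => (j == k i)%:R) _)).
- by move=> i; exact: rmeas_nth.
- move=> i; rewrite (bigD1 (Ordinal (kd i)))//= eqxx expr1n big1 ?addr0// => j /negbTE jk.
  by rewrite (_ : (j == k i :> nat) = false) ?expr0n//; exact: jk.
- move=> i s _; rewrite (bigD1 (Ordinal (kd i)))//= eqxx mul1r.
  rewrite big1 ?addr0// => j /negbTE jk.
  by rewrite (_ : (j == k i :> nat) = false) ?mul0r//; exact: jk.
Qed.

End tame.

(** * Fluctuations of the mean and of the norm of a Gaussian vector *)

Section fluctuations.
Context {R : realType} {J : Type}.
Variables (d : J -> nat) (k : J -> nat).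
Hypothesis d16 : forall i, (16 <= d i)%N.
Hypothesis kd : forall i, (k i < d i)%N.
Implicit Types (i : J) (s : seq R).

Definition sqrtd i : R := Num.sqrt (d i)%:R.

Lemma d_gt0 i : 0 < (d i)%:R :> R.
Proof. by rewrite ltr0n (leq_trans _ (d16 i)). Qed.

(** With a = 1 / sqrt N this gives 2 a <= 1/2, the range in which [gauss_factor_le] holds. *)
Lemma sqrtd_ge4 i : 4 <= sqrtd i.
Proof.
rewrite /sqrtd (_ : 4 = Num.sqrt (4 ^+ 2)); last by rewrite sqrtr_sqr ger0_norm.
by rewrite ler_wsqrtr// -natrX ler_nat.
Qed.

Lemma sqrtd_gt0 i : 0 < sqrtd i.
Proof. by rewrite (lt_le_trans _ (sqrtd_ge4 i)). Qed.

Lemma sqr_sqrtd i : sqrtd i ^+ 2 = (d i)%:R.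
Proof. by rewrite /sqrtd sqr_sqrtr. Qed.

Lemma sumM_nth s : sumM s = \sum_(j < size s) nth 0 s j.
Proof. by rewrite /sumM (big_nth 0) big_mkord. Qed.

Lemma sumN_nth s : sumN s = \sum_(j < size s) nth 0 s j ^+ 2.
Proof. by rewrite /sumN (big_nth 0) big_mkord. Qed.

Lemma tame_sumM : tame d (fun i s => sumM s / sqrtd i).
Proof.
apply: (eq_tame _ _ _ _ (tame_lin d (fun i _ => (sqrtd i)^-1) _)).
- by move=> i; apply: rmeasM; [exact: rmeas_sumM|exact: rmeas_cst].
- move=> i; rewrite sumr_const card_ord -mulr_natl exprVn sqr_sqrtd divff//.
  by rewrite gt_eqF// d_gt0.
- by move=> i s ss; rewrite sumM_nth ss mulr_suml; apply: eq_bigr => j _; rewrite mulrC.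
Qed.

Lemma mean_sumM i s : size s = d i -> mean s = sumM s / sqrtd i / sqrtd i.
Proof. by move=> ss; rewrite /mean ss -mulrA -invfM -expr2 sqr_sqrtd. Qed.

Lemma tame_mean : tame d (fun i s => mean s).
Proof.
apply: (le_tame _ _ _ _ tame_sumM) => [i|i s ss]; first exact: rmeas_mean.
rewrite (mean_sumM _ _ ss) [leLHS]normrM ler_piMr//.
rewrite normfV gtr0_norm ?sqrtd_gt0// invf_le1 ?sqrtd_gt0//.
by apply: le_trans (sqrtd_ge4 i); rewrite ler1n.
Qed.

(** The left side is the expectation of exp (a (x^2 - 1)) for a standard Gaussian x. After squaring,
    1 / (1 - 2a) = 1 + 2a / (1 - 2a) <= exp (2a / (1 - 2a)), and 2a / (1 - 2a) <= 2a + 8a^2 amounts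
    to 4a^2 (1 - 4a) >= 0. *)
Lemma gauss_factor_le (a : R) : `|2 * a| <= 2^-1 ->
  expR (- a) / Num.sqrt (1 - 2 * a) <= expR (4 * a ^+ 2).
Proof.
rewrite ler_norml => /andP[a1 a2].
have b0 : 0 < 1 - 2 * a by lra.
rewrite -(@ler_pXn2r _ 2)// ?nnegrE ?expR_ge0 ?divr_ge0 ?expR_ge0 ?sqrtr_ge0//.
rewrite exprMn exprVn sqr_sqrtr ?(ltW b0)// ler_pdivrMr// -!expRM_natl.
have : 1 <= (1 - 2 * a) * expR (2 * a + 8 * a ^+ 2).
  rewrite -ler_pdivrMl// mulr1.
  apply: (@le_trans _ _ (1 + 2 * a / (1 - 2 * a))).
    by rewrite le_eqVlt; apply/orP; left; apply/eqP; field; rewrite gt_eqF.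
  apply: le_trans (expR_ge1Dx _) _; rewrite ler_expR ler_pdivrMr//.
  have := sqr_ge0 a; nra.
have -> : 2%:R * (4 * a ^+ 2) = 8 * a ^+ 2 by ring.
move=> h; have := ler_wpM2l (expR_ge0 (- (2 * a))) h.
rewrite mulr1 mulrCA -expRD addrA addNr add0r mulrN [X in _ <= X]mulrC; exact.
Qed.

(** Each of the n independent factors is at most exp (4 a^2), and a^2 n = 1 makes their product exp
    4. It is applied with a = 1 / sqrt N and a = - 1 / sqrt N. *)
Lemma gexp_expR_sumN n (a : R) : `|2 * a| <= 2^-1 -> a ^+ 2 * n%:R = 1 ->
  (gexp n (fun s => expR (\sum_(j < n) a * (nth 0 s j ^+ 2 - 1))%R) <= (expR 4)%:E)%E.
Proof.
move=> a2 an; have := a2; rewrite ler_norml => /andP[a3 a4].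
have b0 : 0 < 1 - 2 * a by lra.
rewrite (eq_gexp _ _ (fun s => \prod_(j < n) expR (a * (nth 0 s j ^+ 2 - 1))));
  last by move=> s _; rewrite expR_sum.
rewrite (gexp_prod n (fun _ x => expR (a * (x ^+ 2 - 1)))
  (fun=> expR (- a) / Num.sqrt (1 - 2 * a))).
- rewrite lee_fin prodr_const card_ord.
  have -> : expR 4 = expR (4 * a ^+ 2) ^+ n.
    by rewrite -expRM_natl; congr expR; rewrite mulrCA [n%:R * _]mulrC an mulr1.
  by apply: lerXn2r; rewrite ?nnegrE ?expR_ge0 ?divr_ge0 ?expR_ge0 ?sqrtr_ge0//
    gauss_factor_le.
- by move=> _ x; exact: expR_ge0.
- move=> _; apply: measurableT_comp => //; apply: measurable_funM => //.
  by apply: measurable_funB => //; exact: measurable_funX.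
- move=> _; rewrite EFinM -(integral_std_pdf_expR2 (Num.sqrt (1 - 2 * a))) ?sqrtr_gt0//.
  rewrite -ge0_integralZl ?lee_fin ?expR_ge0//; last 2 first.
  + apply/measurable_EFinP; apply: measurable_funM; last exact: measurable_std_pdf.
    apply: measurableT_comp => //; apply: measurable_funN; apply: measurable_funM => //.
    by apply: measurable_funM => //; exact: measurable_funX.
  + by move=> x _; rewrite lee_fin mulr_ge0 ?expR_ge0// std_pdf_ge0.
  apply: eq_integral => x _; rewrite -EFinM; congr EFin.
  rewrite [RHS]mulrA -expRD; congr (expR _ * _).
  by rewrite sqr_sqrtr ?ltW//; field.
Qed.

Lemma tame_sumN : tame d (fun i s => (sumN s - (d i)%:R) / sqrtd i).
Proof.
have h1 i : `|2 * (sqrtd i)^-1| <= 2^-1.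
  rewrite gtr0_norm ?mulr_gt0 ?invr_gt0 ?sqrtd_gt0// ler_pdivrMr ?sqrtd_gt0//.
  by have := sqrtd_ge4 i; lra.
have h2 i : (sqrtd i)^-1 ^+ 2 * (d i)%:R = 1.
  by rewrite -sqr_sqrtd -exprMn mulVf ?expr1n// gt_eqF// sqrtd_gt0.
have E (c : R) i s : size s = d i -> \sum_(j < d i) c * (nth 0 s j ^+ 2 - 1) =
    c * (sumN s - (d i)%:R).
  by move=> ss; rewrite -mulr_sumr sumrB sumN_nth ss sumr_const card_ord.
apply: (tame_expR _ _ (expR 4)) => i.
- apply: rmeasM; last exact: rmeas_cst.
  by apply: rmeasD; [exact: rmeas_sumN|exact: rmeas_cst].
- have := gexp_expR_sumN _ _ (h1 i) (h2 i); apply: le_trans; rewrite le_eqVlt.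
  by apply/orP; left; apply/eqP/eq_gexp => s ss; rewrite E// mulrC.
- have := gexp_expR_sumN (d i) (- (sqrtd i)^-1); rewrite mulrN normrN sqrrN.
  move=> /(_ (h1 i) (h2 i)); apply: le_trans; rewrite le_eqVlt.
  by apply/orP; left; apply/eqP/eq_gexp => s ss; rewrite E// mulNr mulrC.
Qed.

Lemma sumN_centered i s : size s = d i ->
  sumN (centered s) = sumN s - (d i)%:R * mean s ^+ 2.
Proof.
move=> ss; rewrite (_ : centered s = [seq - mean s + x | x <- s]); last first.
  by apply: eq_map => x; rewrite addrC.
rewrite sumN_shift ss (_ : sumM s = (d i)%:R * mean s); first by ring.
by rewrite /mean ss mulrC divfK// gt_eqF// d_gt0.
Qed.

Definition deviation i s : R := sqrtd i * (1 - sumN (centered s) / (d i)%:R).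

Lemma rmeas_sumN_centered n : rmeas n (fun s => sumN (centered s)).
Proof. by apply: rmeas_center; exact: rmeas_sumN. Qed.

(** By |X'|^2 = |X|^2 - N (mean X)^2, the deviation is minus the normalized fluctuation of |X|^2,
    plus (sqrt N mean X)^2 / sqrt N, where 1 / sqrt N <= 1. *)
Lemma tame_deviation : tame d deviation.
Proof.
have tY := tame_sumM.
apply: (le_tame _ _ (fun i s =>
  `|(sumN s - (d i)%:R) / sqrtd i| + (sumM s / sqrtd i) ^+ 2)).
- move=> i; apply: rmeasM; first exact: rmeas_cst.
  apply: rmeasD; first exact: rmeas_cst.
  apply: rmeasN; apply: rmeasM; last exact: rmeas_cst.
  exact: rmeas_sumN_centered.
- apply: tameD; last exact: (tameM d _ _ tY tY).
  apply: (le_tame _ _ _ _ tame_sumN) => [i|i s _]; last by rewrite normr_id.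
  by apply: rmeas_norm; exact: (tame_rmeas _ _ _ tame_sumN).
- move=> i s ss; have q0 := sqrtd_gt0 i.
  rewrite (_ : deviation i s =
    - ((sumN s - (d i)%:R) / sqrtd i) + (sumM s / sqrtd i) ^+ 2 / sqrtd i); last first.
    rewrite /deviation (sumN_centered i)// (mean_sumM i)// -sqr_sqrtd; field.
    by rewrite gt_eqF.
  rewrite (le_trans (ler_normD _ _))// normrN.
  rewrite [leRHS]ger0_norm ?addr_ge0 ?sqr_ge0// lerD2l ger0_norm.
    rewrite ler_piMr ?sqr_ge0// invf_le1//.
    by apply: le_trans (sqrtd_ge4 i); rewrite ler1n.
  by rewrite divr_ge0 ?sqr_ge0// ltW.
Qed.

Lemma tame_centered : tame d (fun i s => nth 0 s (k i) - mean s).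
Proof. by apply: tameD; [exact: tame_nth|apply: tameN; exact: tame_mean]. Qed.

Lemma bernoulli_ineq (x : R) n : 0 <= x -> 1 + n%:R * x <= (1 + x) ^+ n.
Proof.
move=> x0; elim: n => [|n ih]; first by rewrite mul0r addr0 expr0.
rewrite exprS -natr1; apply: le_trans (ler_wpM2l _ ih); last by rewrite addr_ge0.
have : 0 <= n%:R * x ^+ 2 by rewrite mulr_ge0 ?sqr_ge0.
nra.
Qed.

End fluctuations.

(** * Moments of a coordinate of the projected Gaussian vector *)

Section sphere_coordinates.
Context {R : realType} {J : Type}.
Variables (d : J -> nat) (k : J -> nat).
Hypothesis d16 : forall i, (16 <= d i)%N.
Hypothesis kd : forall i, (k i < d i)%N.
Implicit Types (i : J) (s : seq R).

Lemma sqr_nth_le s j : nth 0 s j ^+ 2 <= sumN s.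
Proof.
have [js|js] := ltnP j (size s); last by rewrite nth_default// expr0n sumN_ge0.
rewrite sumN_nth (bigD1 (Ordinal js))//= lerDl.
by apply: sumr_ge0 => l _; exact: sqr_ge0.
Qed.

(** With N = n + 1 the exponent is 1/8 + 1 / (16 N) <= 3/16, so the exponential is at most 16/13.
    Bernoulli gives a^n >= 2 - 1/N >= 31/16, and 16/13 <= 2/3 * 31/16. *)
Lemma exp_scale_ratio (n : nat) (a : R) : (15 <= n)%N -> a = 1 + n.+1%:R^-1 ->
  expR ((a ^+ 2 - 1) * (n.+1%:R / 8) / 2) <= 2 / 3 * a ^+ n.
Proof.
move=> n15 aE; have d0 : 0 < n.+1%:R :> R by [].
have d16' : 16 <= n.+1%:R :> R by rewrite ler_nat.
have e1 (D : R) : 16 <= D -> ((1 + D^-1) ^+ 2 - 1) * (D / 8) / 2 <= 3 / 16 :> R.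
  move=> D16; rewrite (_ : _ / 2 = 1 / 8 + (16 * D)^-1); last first.
    by field; rewrite gt_eqF//; lra.
  rewrite -lerBrDl (_ : 3 / 16 - 1 / 8 = 16^-1 :> R); last by lra.
  by rewrite lef_pV2 ?posrE ?mulr_gt0//; lra.
have e2 : expR (3 / 16) <= 16 / 13 :> R.
  have h : 13 / 16 <= expR (- (3 / 16)) :> R.
    by apply: le_trans (expR_ge1Dx _); lra.
  have := ler_wpM2l (expR_ge0 (3 / 16 : R)) h.
  by rewrite -expRD addrN expR0; lra.
have e3 : 31 / 16 <= a ^+ n.
  have v0 : 0 <= n.+1%:R^-1 :> R by rewrite invr_ge0.
  have := bernoulli_ineq n.+1%:R^-1 n v0; rewrite -aE; apply: le_trans.
  rewrite -[n%:R](addrK 1) natr1 mulrBl divff ?pnatr_eq0// mul1r.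
  have : n.+1%:R^-1 <= 16^-1 :> R by rewrite lef_pV2 ?posrE//.
  by move: (n.+1%:R^-1) => y; lra.
have : expR ((a ^+ 2 - 1) * (n.+1%:R / 8) / 2) <= expR (3 / 16).
  by rewrite ler_expR aE; exact: e1.
lra.
Qed.

Definition unit_coord i v : R :=
  sqrtd d i * (nth 0 v (k i) / Num.sqrt (sumN v)).

Lemma rmeas_unit_coord n i : rmeas n (unit_coord i).
Proof.
apply: rmeasM; first exact: rmeas_cst.
apply: rmeasM; first exact: rmeas_nth.
apply: (rmeas_fun n (fun x => (Num.sqrt x)^-1)); last exact: rmeas_sumN.
exact: measurable_invsqrt.
Qed.

Lemma unit_coord_homog0 i p : homog0 (fun v => `|unit_coord i v| ^+ p).
Proof.
move=> a s a0; congr (`|_ * _| ^+ _).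
have -> : nth 0 [seq a * x | x <- s] (k i) = a * nth 0 s (k i).
  have [ks|ks] := ltnP (k i) (size s); first by rewrite (nth_map 0).
  by rewrite !nth_default ?size_map// mulr0.
rewrite sumN_scale sqrtrM ?sqr_ge0// sqrtr_sqr gtr0_norm//.
by rewrite -mulf_div divff ?mul1r// gt_eqF.
Qed.

(** This bound grows with N; it makes each moment finite, so that a fraction of it can be subtracted
    from both sides. *)
Lemma unit_coord_le i v : `|unit_coord i v| <= sqrtd d i.
Proof.
rewrite normrM ger0_norm ?sqrtr_ge0// ler_piMr ?sqrtr_ge0// normrM normfV.
rewrite [X in _ / X]ger0_norm ?sqrtr_ge0//.
have [->|v0] := eqVneq (sumN v) 0; first by rewrite sqrtr0 invr0 mulr0.
have v1 : 0 < Num.sqrt (sumN v) by rewrite sqrtr_gt0 lt_neqAle eq_sym v0 sumN_ge0.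
rewrite ler_pdivrMr// mul1r -sqrtr_sqr ler_wsqrtr//.
exact: sqr_nth_le.
Qed.

(* Direction and radius of a Gaussian vector are independent, so that inserting
   the weight [exp (- c |v|^2)] multiplies the moment of the direction by a
   constant factor [a ^- n]; with [c] of order [1 / n] this shows that the part of
   the moment where [|v|^2 < d / 8] is at most 2/3 of the whole. *)
Lemma tame_unit_coord : tame d (fun i s => unit_coord i (centered s)).
Proof.
split=> [i|p]; first by apply: rmeas_center; exact: rmeas_unit_coord.
have [_ /(_ p)[C bC]] := @tame_centered R J d k d16 kd.
(* This solves x <= 8^p C + 2/3 x for the moment x, where C bounds the moment of the centred
   coordinate. *)
exists (3 * (8 ^+ p * C)) => i.
have := bC i; have := d16 i; have := kd i.
case di : (d i) => [|n] kn n16; first by [].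
move: n16; rewrite ltnS => n15 bCi.
pose a : R := 1 + n.+1%:R^-1.
have a0 : 0 < a by rewrite ltr_pwDl.
pose H v := `|unit_coord i v| ^+ p.
have mH : rmeas n.+1 H by apply: rmeas_normX; exact: rmeas_unit_coord.
have H0 v : 0 <= H v by rewrite exprn_ge0.
have mHc : rmeas n.+1 (fun s => H (centered s)) by exact: rmeas_center.
pose w s := expR (- ((a ^+ 2 - 1) * sumN (centered s) / 2)).
have mw : rmeas n.+1 w.
  apply: rmeas_expR; apply: rmeasN; apply: rmeasM; last exact: rmeas_cst.
  by apply: rmeasM; [exact: rmeas_cst|exact: rmeas_sumN_centered].
have mHw : rmeas n.+1 (fun s => H (centered s) * w s) by exact: rmeasM.
have Hw0 s : 0 <= H (centered s) * w s by rewrite mulr_ge0 ?expR_ge0.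
have := gexp_center_scale n H a a0 H0 mH (unit_coord_homog0 i p).
rewrite -/(gexp _ _); set X := gexp _ _; rewrite -/w.
set Y := gexp n.+1 (fun s => H (centered s) * w s) => XY.
have X0 : (0 <= X)%E by exact: gexp_ge0.
have Y0 : (0 <= Y)%E by exact: gexp_ge0.
have Xfin : X \is a fin_num.
  rewrite ge0_fin_numE//; apply: (@le_lt_trans _ _ (sqrtd d i ^+ p)%:E); last exact: ltry.
  rewrite -(gexp_cst n.+1) ?exprn_ge0 ?sqrtr_ge0//; apply: le_gexp => //.
  - by move=> _; rewrite exprn_ge0 ?sqrtr_ge0.
  - by move=> s _; apply: lerXn2r; rewrite ?nnegrE ?sqrtr_ge0// unit_coord_le.
have YX : Y = ((a ^- n)%:E * X)%E.
  by rewrite XY muleA -EFinM mulVf ?mul1e// expf_neq0// gt_eqF.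
pose K := expR ((a ^+ 2 - 1) * (n.+1%:R / 8) / 2).
have main : (X <= (8 ^+ p)%:E * C%:E + K%:E * Y)%E.
  apply: le_trans (leeD2r _ (lee_wpmul2l _ bCi)); last by rewrite lee_fin exprn_ge0.
  have mA : rmeas n.+1 (fun s => `|nth 0 s (k i) - mean s| ^+ p).
    apply: rmeas_normX; apply: rmeasD; first exact: rmeas_nth.
    by apply: rmeasN; exact: rmeas_mean.
  have A0 s : 0 <= 8 ^+ p * `|nth 0 s (k i) - mean s| ^+ p.
    by rewrite mulr_ge0 ?exprn_ge0.
  have mA8 : rmeas n.+1 (fun s => 8 ^+ p * `|nth 0 s (k i) - mean s| ^+ p).
    by apply: rmeasM => //; exact: rmeas_cst.
  have mK : rmeas n.+1 (fun s => K * (H (centered s) * w s)).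
    by apply: rmeasM => //; exact: rmeas_cst.
  have K0 s : 0 <= K * (H (centered s) * w s) by rewrite mulr_ge0 ?expR_ge0.
  rewrite -gexpZ ?exprn_ge0// -gexpZ ?expR_ge0// -gexpD//.
  apply: le_gexp => //.
  - exact: rmeasD.
  - by move=> s; rewrite addr_ge0.
  - move=> s ss; have nc : nth 0 (centered s) (k i) = nth 0 s (k i) - mean s.
      by rewrite (nth_map 0) ?ss.
    (* Where |v|^2 >= N / 8, sqrt N / |v| <= sqrt 8 <= 8, so the coordinate on the sphere is at most
       8 times the centred one. *)
    have [big|small] := leP (n.+1%:R / 8) (sumN (centered s)).
      rewrite (le_trans (_ : _ <= 8 ^+ p * `|nth 0 s (k i) - mean s| ^+ p)) ?lerDl//.
      rewrite -exprMn -nc; apply: lerXn2r; rewrite ?nnegrE ?mulr_ge0//.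
      set S := sumN _ in big *.
      have S0 : 0 < S by apply: lt_le_trans big; rewrite divr_gt0.
      rewrite normrM normrM normfV ger0_norm ?sqrtr_ge0//.
      rewrite [X in _ / X]ger0_norm ?sqrtr_ge0// mulrCA mulrC ler_wpM2r//.
      rewrite ler_pdivrMr ?sqrtr_gt0// /sqrtd di.
      rewrite (_ : 8 = Num.sqrt (8 ^+ 2)); last by rewrite sqrtr_sqr ger0_norm.
      rewrite -sqrtrM ?sqr_ge0// ler_wsqrtr// -/S; lra.
    (* Where |v|^2 < N / 8, the choice of [K] gives K w >= 1, since a >= 1. *)
    rewrite (le_trans (_ : _ <= K * (H (centered s) * w s))) ?lerDr//.
    rewrite mulrCA ler_peMr// /K /w -expRD -[leLHS](@expR0 R) ler_expR -!mulrBl -mulrBr.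
    rewrite divr_ge0// mulr_ge0//; last by rewrite subr_ge0 ltW.
    have : 1 <= a by rewrite lerDl invr_ge0.
    nra.
move: main; rewrite YX; case: X Xfin X0 {XY YX} => [x| |]// _ X0 main.
have x0 : 0 <= x by rewrite -lee_fin; exact: X0.
rewrite lee_fin; move: main; rewrite -!EFinM -EFinD lee_fin => main.
have Ka : K <= 2 / 3 * a ^+ n by exact: exp_scale_ratio.
have : K * (a ^- n * x) <= 2 / 3 * x.
  by rewrite mulrA ler_wpM2r// ler_pdivrMr// exprn_gt0.
lra.
Qed.

End sphere_coordinates.

(** * Distance between the coupled coordinates *)

Section comparison.
Context {R : realType} {J : Type}.
Variables (d : J -> nat) (k : J -> nat).
Hypothesis d16 : forall i, (16 <= d i)%N.
Hypothesis kd : forall i, (k i < d i)%N.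
Implicit Types (i : J) (s : seq R).

(** From 1 - z = (1 - sqrt z) (1 + sqrt z). It passes from the norm of X', which the coupling
    contains, to its square, which [deviation] controls. *)
Lemma normB1_sqrt_le (z : R) : 0 <= z -> `|1 - Num.sqrt z| <= `|1 - z|.
Proof.
move=> z0; have s0 := sqrtr_ge0 z.
rewrite -[in leRHS](sqr_sqrtr z0) -{2}[1](expr1n _ 2) subr_sqr normrM.
by rewrite ler_peMr// ger0_norm; lra.
Qed.

Lemma nth_unit_coord i s : size s = d i ->
  nth 0 s (k i) = unit_coord d k i (centered s) *
    Num.sqrt (sumN (centered s) / (d i)%:R) + mean s.
Proof.
move=> ss; rewrite /unit_coord; set S := sumN _.
have q0 : 0 < sqrtd d i :> R by exact: (@sqrtd_gt0 R J d d16).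
rewrite sqrtrM ?sumN_ge0// sqrtrV// -/(sqrtd d i).
have nc : nth 0 (centered s) (k i) = nth 0 s (k i) - mean s.
  by rewrite (nth_map 0) ?ss.
(* If X' = 0, the coordinate on the sphere is 0 by division by zero, and the identity survives
   because the coordinate of X' vanishes too. *)
have [S0|S0] := eqVneq S 0.
  rewrite S0 sqrtr0 !mul0r mulr0 add0r; apply/eqP; rewrite -subr_eq0 -nc -sqrf_eq0.
  by rewrite eq_le sqr_ge0 andbT -[leRHS]S0 sqr_nth_le.
have S1 : Num.sqrt S != 0 by rewrite sqrtr_eq0 -ltNge lt_neqAle eq_sym S0 sumN_ge0.
by rewrite nc; field; rewrite S1 gt_eqF.
Qed.

Lemma tame_unit_coord_diff :
  tame d (fun i s => sqrtd d i * (unit_coord d k i (centered s) - nth 0 s (k i))).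
Proof.
have tU := @tame_unit_coord R J d k d16 kd.
have tD := @tame_deviation R J d d16.
have tS := @tame_sumM R J d d16.
have m0 i : rmeas (d i) (fun s => sqrtd d i *
    (unit_coord d k i (centered s) - nth 0 s (k i))).
  apply: rmeasM; first exact: rmeas_cst.
  by apply: rmeasD; [exact: tame_rmeas tU|apply: rmeasN; exact: rmeas_nth].
apply: (le_tame _ _ (fun i s => `|unit_coord d k i (centered s) * deviation d i s|
                                + `|sumM s / sqrtd d i|)) => //.
  apply: tameD.
    apply: (le_tame _ _ _ _ (tameM _ _ _ tU tD)) => [i|i s _]; last by rewrite normr_id.
    by apply: rmeas_norm; exact: (tame_rmeas _ _ _ (tameM _ _ _ tU tD)).
  apply: (le_tame _ _ _ _ tS) => [i|i s _]; last by rewrite normr_id.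
  by apply: rmeas_norm; exact: (tame_rmeas _ _ _ tS).
move=> i s ss; rewrite [in leLHS](nth_unit_coord i s ss).
have q0 : 0 < sqrtd d i :> R by exact: (@sqrtd_gt0 R J d d16).
set U := unit_coord _ _ _ _; set z := sumN _ / _.
have z0 : 0 <= z by rewrite divr_ge0 ?sumN_ge0.
rewrite (mean_sumM d i s ss) [leRHS]ger0_norm ?addr_ge0//.
rewrite (_ : _ * _ = U * (sqrtd d i * (1 - Num.sqrt z)) - sumM s / sqrtd d i); last first.
  by field; rewrite gt_eqF.
rewrite (le_trans (ler_normB _ _))// lerD2r /deviation -/z !normrM.
by rewrite !ler_wpM2l// normB1_sqrt_le.
Qed.

End comparison.

(** * Observables: measurability and stability under the coupling *)

Section observables.
Context {R : realType} {n : nat}.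
Implicit Types (f : ('I_n -> R) -> R) (y z : 'I_n -> R).

Lemma sqrt_sumX2_le (r : seq 'I_n) y :
  Num.sqrt (\sum_(i <- r) y i ^+ 2) <= \sum_(i <- r) `|y i|.
Proof.
have y0 (r' : seq 'I_n) : 0 <= \sum_(i <- r') `|y i| by apply: sumr_ge0.
rewrite -[leRHS]ger0_norm// -sqrtr_sqr ler_wsqrtr//.
elim: r => [|i r ih]; first by rewrite !big_nil expr0n.
rewrite !big_cons sqrrD real_normK ?num_real// -addrA lerD2l (le_trans ih)// lerDr.
by rewrite mulrn_wge0// mulr_ge0.
Qed.

(** In the l1 form the bound is a sum over coordinates, to which [tame_sum] applies. *)
Lemma lipschitz_l1 f : bounded_1lipschitz f ->
  forall y z, `|f y - f z| <= \sum_i `|y i - z i|.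
Proof.
move=> [_ fL] y z; apply: le_trans (fL y z) _.
exact: (sqrt_sumX2_le _ (fun i => y i - z i)).
Qed.

(* [f] is the infimum of the measurable functions [y |-> f q + |y - q|_1] over
   the countably many rational points [q]. *)
Lemma measurable_lipschitz f d (T : measurableType d) (g : 'I_n -> T -> R) :
  (forall y z, `|f y - f z| <= \sum_i `|y i - z i|) ->
  (forall i, measurable_fun setT (g i)) ->
  measurable_fun setT (fun t => f (g ^~ t)).
Proof.
move=> fL mg mT; apply: (measurability _ (RGenInftyO.measurableE R)) => //.
move=> /= _ [_ [a ->] <-].
pose h (q : {ffun 'I_n -> rat}) t :=
  f (fun i => ratr (q i)) + \sum_i `|g i t - ratr (q i)|.
have mh q : measurable_fun setT (h q).
  apply: measurable_funD; first exact: measurable_cst.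
  apply: measurable_sum => i; apply: measurableT_comp; first exact: normr_measurable.
  by apply: measurable_funB => //; exact: measurable_cst.
rewrite [X in measurable X](_ : _ = \bigcup_q (setT `&` h q @^-1` `]-oo, a[))%classic.
  apply: countable_bigcupT_measurable; first exact: countableP.
  by move=> q; apply: mh => //; exact: measurable_itv.
apply/seteqP; split => [t [_]|t [q _ [_]]] /=; rewrite !in_itv/=.
(* A rational point q within e of each coordinate has l1 distance at most n e, so f q plus that
   distance is at most f + 2 n e, which is below a; n + 1 in place of n gives strictness and covers
   n = 0. *)
- move=> fa; pose e := (a - f (g^~ t)) / (2 * n.+1%:R).
  have e0 : 0 < e by rewrite divr_gt0 ?subr_gt0// mulr_gt0.
  have Q i : {q : rat | `|g i t - ratr q| < e}.
    apply: cid; have /rat_in_itvoo[q] : g i t - e < g i t + e by rewrite ltrD2l gtrN.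
    rewrite in_itv/= => /andP[q1 q2]; exists q; rewrite ltr_norml; apply/andP; split; lra.
  exists [ffun i => sval (Q i)] => //; split => //=; rewrite in_itv/= /h.
  set q := (fun i => ratr _); set D := \sum_i _.
  have DE : D = \sum_i `|g i t - q i| by [].
  have De : D <= n%:R * e.
    rewrite mulr_natl -[X in _ *+ X](card_ord n) -sumr_const; apply: ler_sum => i _.
    by rewrite ffunE ltW//; case: (Q i).
  have := fL (g^~ t) q; rewrite -DE ler_norml => /andP[f1 f2].
  have : a - f (g^~ t) = 2 * (n%:R * e) + 2 * e.
    by rewrite /e -natr1; field; rewrite addrC natr1 pnatr_eq0.
  lra.
- move=> ha; have := fL (g^~ t) (fun i => ratr (q i)); rewrite ler_norml => /andP[_ f2].
  by move: ha; rewrite /h; lra.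
Qed.

Lemma measurable_observable f d (T : measurableType d) (g : 'I_n -> T -> R) :
  bounded_1lipschitz f \/ coord_monomial f ->
  (forall i, measurable_fun setT (g i)) ->
  measurable_fun setT (fun t => f (g ^~ t)).
Proof.
move=> [fL|[l [j fE]]] mg.
  by apply: measurable_lipschitz mg; exact: lipschitz_l1.
under eq_fun do rewrite fE.
by apply: measurable_prod => i _.
Qed.

Lemma rmeas_observable f N (F : 'I_n -> seq R -> R) :
  bounded_1lipschitz f \/ coord_monomial f -> (forall j, rmeas N (F j)) ->
  rmeas N (fun s => f (fun j => F j s)).
Proof.
move=> ff mF d' T h mh.
apply: (measurable_observable f _ _ (fun j t => F j (mkseq (h^~ t) N)) ff) => j.
exact: mF.
Qed.

Section tame_observable.
Context {J : Type}.
Variables (d : J -> nat) (c : J -> R) (F G : 'I_n -> J -> seq R -> R).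
Hypothesis tF : forall j, tame d (F j).
Hypothesis tG : forall j, tame d (G j).
Hypothesis tFG : forall j, tame d (fun i s => c i * (F j i s - G j i s)).

Lemma tame_observable f : bounded_1lipschitz f \/ coord_monomial f ->
  tame d (fun i s => f (fun j => F j i s)).
Proof.
move=> ff; have mf i : rmeas (d i) (fun s => f (fun j => F j i s)).
  apply: (rmeas_observable f _ (fun j => F j i) ff) => j.
  exact: (tame_rmeas _ _ i (tF j)).
case: ff => [[[B fB] _]|[l [j fE]]].
  apply: (le_tame _ _ _ _ (tame_cst _ B)) => // i s _.
  by apply: le_trans (ler_norm B).
exact: (eq_tame _ _ _ _ (tame_prod _ _ (index_enum _) (fun l => F (j l)) _)).
Qed.

(** A Lipschitz observable is dominated by the sum of the scaled coordinate differences; for a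
    monomial the difference telescopes. *)
Lemma tame_observable_diff f :
  bounded_1lipschitz f \/ coord_monomial f ->
  tame d (fun i s => c i * (f (fun j => F j i s) - f (fun j => G j i s))).
Proof.
move=> ff.
have m (H : 'I_n -> J -> seq R -> R) i : (forall j, tame d (H j)) ->
    rmeas (d i) (fun s => f (fun j => H j i s)).
  move=> tH; apply: (rmeas_observable f _ (fun j => H j i) ff) => j.
  exact: (tame_rmeas _ _ i (tH j)).
have mF i := m F i tF; have mG i := m G i tG; case: ff => [fL|[l [j fE]]].
  have tS : tame d (fun i s => \sum_j `|c i * (F j i s - G j i s)|).
    apply: tame_sum => j; apply: (le_tame _ _ _ _ (tFG j)) => [i|i s _].
      by apply: rmeas_norm; exact: (tame_rmeas _ _ i (tFG j)).
    by rewrite normr_id.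
  apply: (le_tame _ _ _ _ tS) => [i|i s _].
    apply: rmeasM; first exact: rmeas_cst.
    by apply: rmeasD => //; exact: rmeasN.
  rewrite [leRHS]ger0_norm ?sumr_ge0// normrM.
  under eq_bigr do rewrite normrM; rewrite -mulr_sumr ler_wpM2l//.
  exact: (lipschitz_l1 f fL).
apply: (eq_tame _ _ _ _ (tame_prod_diff _ c _ (index_enum _)
  (fun l => F (j l)) (fun l => G (j l)) _ _ _)) => //.
- move=> i; apply: rmeasM; first exact: rmeas_cst.
  by apply: rmeasD => //; exact: rmeasN.
- by move=> i s _; rewrite !fE.
Qed.

End tame_observable.
End observables.

(** * From absolute moments to signed expectations *)

Section approximation.
Context {R : realType}.
Implicit Types F G : seq R -> R.

Lemma gexp_fin n F (C : R) : (forall s, 0 <= F s) -> (gexp n F <= C%:E)%E ->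
  exists2 x : R, gexp n F = x%:E & x <= C.
Proof.
move=> F0 FC; have := gexp_ge0 n F F0; case E : (gexp n F) FC => [x| |]// FC _.
by exists x.
Qed.

Lemma gexp_le_add n F G H : rmeas n F -> rmeas n G -> rmeas n H ->
  (forall s, 0 <= F s) -> (forall s, 0 <= G s) -> (forall s, 0 <= H s) ->
  (forall s, F s <= G s + H s) -> (gexp n F <= gexp n G + gexp n H)%E.
Proof.
move=> mF mG mH F0 G0 H0 FGH; rewrite -gexpD//.
by apply: le_gexp => //; [exact: rmeasD|move=> s; rewrite addr_ge0].
Qed.

(** The signed expectations need finite positive and negative parts: those of [G] are finite by its
    first absolute moment, those of [F] by comparison with [G]. Each part moves by at most D, whence
    the factor 2. *)
Lemma gexp_parts_close n F G (B D : R) : rmeas n F -> rmeas n G ->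
  (gexp n (fun s => `|G s|)%R <= B%:E)%E ->
  (gexp n (fun s => `|F s - G s|%R) <= D%:E)%E ->
  exists ap an bp bn : R,
    [/\ gexp n (fun s => Num.max (F s) 0) = ap%:E,
        gexp n (fun s => Num.max (- F s) 0) = an%:E,
        gexp n (fun s => Num.max (G s) 0) = bp%:E,
        gexp n (fun s => Num.max (- G s) 0) = bn%:E &
        `|(ap - an) - (bp - bn)| <= 2 * D].
Proof.
move=> mF mG GB FD.
have M0 (x : R) : 0 <= Num.max x 0 by rewrite le_max lexx orbT.
have mm (H : seq R -> R) : rmeas n H -> rmeas n (fun s => Num.max (H s) 0).
  exact: rmeas_max0.
have mFG : rmeas n (fun s => `|F s - G s|).
  by apply: rmeas_norm; apply: rmeasD => //; exact: rmeasN.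
have mNF := rmeasN _ _ mF; have mNG := rmeasN _ _ mG.
have [D' ED DD] := gexp_fin n _ D (fun s => normr_ge0 (F s - G s)) FD.
have GBp : (gexp n (fun s => Num.max (G s) 0)%R <= B%:E)%E.
  apply: le_trans GB; apply: le_gexp => //; [exact: mm|exact: rmeas_norm|].
  by move=> s _; rewrite ge_max ler_norm normr_ge0.
have GBn : (gexp n (fun s => Num.max (- G s) 0)%R <= B%:E)%E.
  apply: le_trans GB; apply: le_gexp => //; [exact: mm|exact: rmeas_norm|].
  by move=> s _; rewrite ge_max -normrN ler_norm normr_ge0.
have [bp Ebp _] := gexp_fin n _ B (fun s => M0 (G s)) GBp.
have [bn Ebn _] := gexp_fin n _ B (fun s => M0 (- G s)) GBn.
have max_le (x y z : R) : x <= y + z -> 0 <= z -> Num.max x 0 <= Num.max y 0 + z.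
  move=> xyz z0; rewrite ge_max; apply/andP; split; last by rewrite addr_ge0.
  by apply: le_trans xyz _; rewrite lerD2r le_max lexx.
have close (H K : seq R -> R) (x : R) : rmeas n H -> rmeas n K ->
    (forall s, H s <= K s + `|F s - G s|) ->
    gexp n (fun s => Num.max (K s) 0) = x%:E ->
    (gexp n (fun s => Num.max (H s) 0)%R <= (x + D')%:E)%E.
  move=> mH mK HK Ex; rewrite EFinD -Ex -ED; apply: gexp_le_add => //.
  - exact: mm.
  - exact: mm.
  - by move=> s; exact: max_le.
have dist s : [/\ F s <= G s + `|F s - G s|, G s <= F s + `|F s - G s|,
    - F s <= - G s + `|F s - G s| & - G s <= - F s + `|F s - G s|].
  have := ler_norm (F s - G s); have := ler_norm (- (F s - G s)).
  by rewrite normrN => h1 h2; split; lra.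
have hp : (gexp n (fun s => Num.max (F s) 0)%R <= (bp + D')%:E)%E.
  by apply: (close _ G) => // s; case: (dist s).
have hn : (gexp n (fun s => Num.max (- F s) 0)%R <= (bn + D')%:E)%E.
  by apply: (close _ (fun s => - G s)) => // s; case: (dist s).
have [ap Eap apb] := gexp_fin n _ _ (fun s => M0 (F s)) hp.
have [an Ean anb] := gexp_fin n _ _ (fun s => M0 (- F s)) hn.
exists ap, an, bp, bn; split => //.
have : (bp%:E <= (ap + D')%:E)%E.
  by rewrite -Ebp; apply: (close _ F) => // s; case: (dist s).
have : (bn%:E <= (an + D')%:E)%E.
  by rewrite -Ebn; apply: (close _ (fun s => - F s)) => // s; case: (dist s).
rewrite !lee_fin ler_norml => h1 h2; apply/andP; split; lra.
Qed.

End approximation.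

(** * Comparison of the two ensembles *)

Theorem theorem4p28 (R : realType) (rho m : R) (n : nat)
    (f : ('I_n -> R) -> R) :
  0 < rho -> - Num.sqrt rho < m -> m < Num.sqrt rho ->
  bounded_1lipschitz f \/ coord_monomial f ->
  exists (C : R) (N0 : nat), forall (N : nat) (I : 'I_n -> nat),
    (N0 <= N)%N -> injective I -> (forall i, (I i < N)%N) ->
    let mu := - (m / (rho - m ^+ 2)) in
    let eta := 1 / (2 * (rho - m ^+ 2)) in
    let EMC := mc_expect m rho N (fun phi => f (proj_I I phi)) in
    let EGC := gc_expect mu eta N (fun phi => f (proj_I I phi)) in
    EMC \is a fin_num /\ EGC \is a fin_num /\
    `| fine EMC - fine EGC | <= C / Num.sqrt N%:R.
Proof.
move=> rho0 m1 m2 ff.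
have v0 : 0 < rho - m ^+ 2.
  rewrite subr_gt0 -(sqr_sqrtr (ltW rho0)) -real_normK ?num_real//.
  by rewrite ltr_pXn2r ?nnegrE ?sqrtr_ge0// ltr_norml m1 m2.
set v := rho - m ^+ 2 in v0 *; pose sg := Num.sqrt v.
(* All admissible pairs of dimension and sites form one index type, so the constants obtained below
   serve every N and I at once. *)
pose J := {p : nat * ('I_n -> nat) | (16 <= p.1)%N /\ forall j, (p.2 j < p.1)%N}.
pose d (i : J) := (sval i).1; pose k (j : 'I_n) (i : J) := (sval i).2 j.
have d16 i : (16 <= d i)%N by case: i => p h; have [h1 _] := h; exact: h1.
have kd j i : (k j i < d i)%N by case: i => p h; have [_ h2] := h; exact: h2.
pose F j i s : R := m + sg * unit_coord d (k j) i (centered s).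
pose G j i s : R := sg * nth 0 s (k j i) + m.
have tF j : tame d (F j).
  apply: tameD; first exact: tame_cst.
  by apply: tameM; [exact: tame_cst|exact: tame_unit_coord].
have tG j : tame d (G j).
  apply: tameD; last exact: tame_cst.
  by apply: tameM; [exact: tame_cst|exact: tame_nth].
have tFG j : tame d (fun i s => sqrtd d i * (F j i s - G j i s)).
  apply: (eq_tame _ _ _ _ (tameM _ _ _ (tame_cst _ sg)
    (tame_unit_coord_diff d (k j) d16 (kd j)))) => [i|i s _].
    apply: rmeasM; first exact: rmeas_cst.
    apply: rmeasD; first exact: (tame_rmeas _ _ i (tF j)).
    by apply: rmeasN; exact: (tame_rmeas _ _ i (tG j)).
  by rewrite /F /G; ring.
(* Higher moments were required for products of coordinates; for the observable itself the first
   moment p = 1 suffices. *)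
have [mfG /(_ 1%N)[B bB]] := tame_observable d G tG f ff.
have [mfF _] := tame_observable d F tF f ff.
have [_ /(_ 1%N)[D bD]] := tame_observable_diff d _ F G tF tG tFG f ff.
exists (2 * D), 16%N => -[//|N] I N16 _ IN mu eta EMC EGC.
pose i : J := exist _ (N.+1, I) (conj N16 IN).
have q0 : 0 < sqrtd d i :> R by exact: sqrtd_gt0.
have mo : rmeas N.+1 (fun s => f (proj_I I s)).
  by apply: (rmeas_observable f _ (fun j s => nth 0 s (I j))) => // j; exact: rmeas_nth.
(* The radius sqrt (N v) splits as sqrt N, which is part of [unit_coord], times [sg]. *)
have mcE s : size s = N.+1 ->
    proj_I I (sphere_map m (Num.sqrt (N.+1%:R * v)) (centered s)) = (fun j => F j i s).
  move=> ss; apply/funext => j; rewrite /proj_I (nth_map 0) ?size_map ?ss//.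
  by rewrite /F /unit_coord sqrtrM// -/sg; congr (_ + _); rewrite -[in LHS]mulrA mulrCA.
have gcE s : size s = N.+1 ->
    proj_I I [seq sg * x + m | x <- s] = (fun j => G j i s).
  by move=> ss; apply/funext => j; rewrite /proj_I (nth_map 0) ?ss.
have bG : (gexp N.+1 (fun s => `|f (fun j => G j i s)|)%R <= B%:E)%E.
  by have := bB i; under eq_gexp do rewrite expr1.
have bFG : (gexp N.+1 (fun s => `|f (fun j => F j i s) - f (fun j => G j i s)|%R)
    <= (D / sqrtd d i)%:E)%E.
  have := bD i; under eq_gexp do rewrite expr1 normrM (gtr0_norm q0).
  rewrite gexpZ ?(ltW q0)//; last first.
    apply: rmeas_norm; apply: rmeasD; first exact: mfF.
    by apply: rmeasN; exact: mfG.
  by rewrite mulrC EFinM lee_pdivlMl.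
have [ap [an [bp [bn [Eap Ean Ebp Ebn close]]]]] :=
  gexp_parts_close N.+1 _ _ B _ (mfF i) (mfG i) bG bFG.
have -> : EMC = (ap - an)%:E.
  apply: (mc_expectE N m rho ap an _ v0 mo).
    by rewrite -Eap; apply: eq_gexp => s ss; rewrite -mcE.
  by rewrite -Ean; apply: eq_gexp => s ss; rewrite -mcE.
have -> : EGC = (bp - bn)%:E.
  apply: (gc_expectE N.+1 m v bp bn _ v0 mo).
    by rewrite -Ebp; apply: eq_gexp => s ss; rewrite -gcE.
  by rewrite -Ebn; apply: eq_gexp => s ss; rewrite -gcE.
by rewrite -mulrA.
Qed.
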